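(* For every $\beta>0$ and $\varepsilon>0$ there exist constants $\delta>0$ and $C>0$ such that the following holds. Let $k=k(n)$ satisfy $\beta n<k<(1/2-\beta)n$, let $N=\binom{n}{k}$, $D=\binom{n-k}{k}$, and let $p=p(n)\ge C\cdot D^{-1}$. Then asymptotically almost surely, for every intersecting family $\mathcal{F}\subseteq\mathcal{H}^k(n,p)$ with $|\mathcal{F}|\ge(1-\delta)p(k/n)N$, there is an element $i\in[n]$ that is contained in all but at most $\varepsilon p(k/n)N$ members of $\mathcal{F}$.
   Context: $\mathcal{H}^k(n,p)$ is the binomial random $k$-uniform hypergraph on vertex set $[n]=\{1,\dots,n\}$: each $k$-element subset of $[n]$ is an edge independently with probability $p$. A family of sets is intersecting if every two of its members intersect. ''Asymptotically almost surely'' means with probability tending to $1$ as $n\to\infty$. *)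

(* Defs.v *)
From HB Require Import structures.
From mathcomp Require Import all_boot all_order all_algebra.
From mathcomp Require Import all_classical all_reals all_analysis.

Set Implicit Arguments.
Unset Strict Implicit.
Unset Printing Implicit Defensive.

Import Order.TTheory GRing.Theory Num.Theory.
Import numFieldNormedType.Exports.

Local Open Scope ring_scope.

Definition ksets (n k : nat) : {set {set 'I_n}} :=
  [set e : {set 'I_n} | #|e| == k]%SET.

(* The law of H^k(n,p): the product, over all k-subsets e of [n], of the
   Bernoulli(p) laws of the events "e is an edge". *)
Definition hyp_weight (R : realType) (n k : nat) (p : R)
    (H : {set {set 'I_n}}) : R :=
  \prod_(e in ksets n k) (if e \in H then p else 1 - p).

Definition hyp_prob (R : realType) (n k : nat) (p : R)
    (E : pred {set {set 'I_n}}) : R :=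
  \sum_(H : {set {set 'I_n}} | (H \subset ksets n k) && E H)
    hyp_weight k p H.

Definition intersecting (T : finType) (F : {set {set T}}) : bool :=
  [forall A in F, forall B in F, (A :&: B)%SET != finset.set0].

Definition missing (T : finType) (F : {set {set T}}) (i : T) : {set {set T}} :=
  [set A in F | i \notin A]%SET.

Lemma hyp_prob_total (R : realType) (n k : nat) (p : R) :
  hyp_prob k p (@predT {set {set 'I_n}}) = 1.
Proof.
pose F (e : {set 'I_n}) : R := if e \in ksets n k then p else 0.
pose G (e : {set 'I_n}) : R := if e \in ksets n k then 1 - p else 1.
have h : \prod_e (F e + G e) = 1.
  rewrite big1 // => e _; rewrite /F /G.
  by case: ifP => _; rewrite ?add0r // addrC subrK.
rewrite -{}h bigA_distr /hyp_prob big_mkcond; apply: eq_bigr => H _.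
rewrite andbT; case: ifPn => [sH|/subsetPn[e eH eN]]; last first.
  by rewrite (bigD1 e) //= eH /F (negbTE eN) mul0r.
rewrite /hyp_weight big_mkcond; apply: eq_bigr => e _; rewrite /F /G.
case: (boolP (e \in ksets n k)) => // eN.
by case: ifP => // /(fintype.subsetP sH); rewrite (negbTE eN).
Qed.

(* Main.v *)
(** Stability for the Kneser graph.  Let S be a family of k-sets of density
mu >= (1 - theta) k/n in which every member is disjoint from at most
theta 'C(n-k, k) others.  Write 1_S = mu + G + h with G = sum_i a_i x_i,
sum_i a_i = 0, and h orthogonal to all affine functions of the x_i.  The
normalized Kneser operator has eigenvalue -r = -k/(n-k) on G and norm at most
r^2 < r on h, so the sparsity of S forces h to be small in L^2 and mu to be
close to k/n.  Then (1_S - mu)^3 and G^3 have nearly the same mean, the fourth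
moment of G being bounded.  The second and third moments of G are multiples of
sum a_i^2 and sum a_i^3, and since k/n stays away from 1/2 the comparison gives
sum a_i^2 ~ sum a_i^3 ~ 1.  Hence some a_i is close to 1, that is, S is almost
contained in the star of i.

Transfer to the random hypergraph.  By the graph container algorithm every
intersecting family F lies in the union of T and S(T) for some T contained in F with
|T| <= N / (theta D), where S(T) is sparse in the above sense.  By stability
S(T) is either too small to contain a large F or almost a star; a Chernoff
bound and a union bound over T, weighted by P(T contained in H) = p^|T|,
finish the proof because p D is at least a large constant. *)

Require Import Defs.
From HB Require Import structures.
From mathcomp Require Import all_boot all_order all_algebra.
From mathcomp Require Import all_classical all_reals all_analysis.
From mathcomp Require Import fintype finset bigop.
From mathcomp Require Import zify ring lra.

Set Implicit Arguments.
Unset Strict Implicit.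
Unset Printing Implicit Defensive.

Import Order.TTheory GRing.Theory Num.Theory.
Import numFieldNormedType.Exports.

Local Open Scope ring_scope.

(** * Up and down operators on slices *)

Section UpDown.
Variables (R : realFieldType) (n : nat).
Implicit Types (h g : {set 'I_n} -> R) (A B C : {set 'I_n}).

(** Both operators act on functions of all subsets; the level enters only through the sums over
    [ksets]. *)
Definition up h B : R := \sum_(x in B) h (B :\ x).
Definition down h C : R := \sum_(x in ~: C) h (x |: C).

(** Double counting of pairs of sets that differ by one element x: deleting x from B and adding x to
    A are mutually inverse. *)
Lemma sum_flags m (phi : {set 'I_n} -> 'I_n -> {set 'I_n} -> R) :
  \sum_(B in ksets n m.+1) \sum_(x in B) phi (B :\ x) x B =
  \sum_(A in ksets n m) \sum_(x in ~: A) phi A x (x |: A).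
Proof.
rewrite (exchange_big_dep predT) //= [RHS](exchange_big_dep predT) //=.
apply: eq_bigr => x _.
rewrite (reindex_onto (fun A => x |: A) (fun B => B :\ x)) /=; last first.
  by move=> B /andP[_ xB]; rewrite setD1K.
apply: eq_big => A; rewrite !inE.
  rewrite eqxx /= andbT; case: (boolP (x \in A)) => xA /=.
    rewrite andbF; apply/negbTE/negP => /andP[_ /eqP e].
    by move: xA; rewrite -e !inE eqxx.
  by rewrite setU1K // eqxx cardsU1 xA add1n eqSS !andbT.
by move=> /andP[_ /eqP ->].
Qed.

Lemma up_down_adjoint m h g :
  \sum_(B in ksets n m.+1) up h B * g B =
  \sum_(A in ksets n m) h A * down g A.
Proof.
transitivity (\sum_(B in ksets n m.+1) \sum_(x in B) h (B :\ x) * g B).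
  by apply: eq_bigr => B _; rewrite mulr_suml.
rewrite (sum_flags m (fun A x B => h A * g B)).
by apply: eq_bigr => A _; rewrite mulr_sumr.
Qed.

(** The terms that exchange an x outside A for a y in A occur in both compositions and cancel. The
    remaining terms return to A, once for each of the n - m elements outside in one order and once
    for each of the m elements inside in the other. *)
Lemma down_up_commutator m h A : A \in ksets n m ->
  down (up h) A = up (down h) A + (n%:R - 2 * m%:R) * h A.
Proof.
rewrite inE => /eqP cA.
have cC : #|~: A| = (n - m)%N by rewrite -cA cardsCs setCK card_ord.
pose S : R := \sum_(x in ~: A) \sum_(y in A) h ((x |: A) :\ y).
have -> : down (up h) A = S + (n - m)%:R * h A.
  rewrite /down /up.
  transitivity (\sum_(x in ~: A) (\sum_(y in A) h ((x |: A) :\ y) + h A)).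
    apply: eq_bigr => x; rewrite inE => xA.
    by rewrite big_setU1 //= setU1K // addrC.
  by rewrite big_split /= sumr_const cC mulr_natl.
have -> : up (down h) A = S + m%:R * h A.
  rewrite /down /up /S exchange_big /=.
  transitivity (\sum_(y in A) (\sum_(x in ~: A) h ((x |: A) :\ y) + h A)).
    apply: eq_bigr => y yA.
    have -> : ~: (A :\ y) = y |: ~: A.
      by apply/setP => z; rewrite !inE negb_and negbK.
    rewrite big_setU1 ?inE ?yA //= setD1K // addrC; congr (_ + _).
    apply: eq_bigr => x; rewrite inE => xA; congr h.
    apply/setP => z; rewrite !inE; case: (eqVneq z x) => // ->.
    by rewrite andbT; case: eqVneq => // e; rewrite e yA in xA.
  by rewrite big_split /= sumr_const cA mulr_natl.
have mn : (m <= n)%N by rewrite -cA -[n in (_ <= n)%N]card_ord max_card.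
by rewrite natrB //; ring.
Qed.

Definition sqnorm m h : R := \sum_(A in ksets n m) h A ^+ 2.

Lemma sqnorm_ge0 m h : 0 <= sqnorm m h.
Proof. by apply: sumr_ge0 => A _; rewrite sqr_ge0. Qed.

(** By adjointness |up h|^2 = <h, down (up h)>; the commutator turns this into <h, up (down h)> =
    |down h|^2 plus a multiple of |h|^2. *)
Lemma sqnorm_up m h :
  sqnorm m.+2 (up h) = sqnorm m (down h) + (n%:R - 2 * m.+1%:R) * sqnorm m.+1 h.
Proof.
have -> : sqnorm m.+2 (up h) = \sum_(A in ksets n m.+1) h A * down (up h) A.
  by rewrite -up_down_adjoint; apply: eq_bigr => B _; rewrite expr2.
under eq_bigr => A hA do rewrite (down_up_commutator _ hA) mulrDr.
rewrite big_split /=; congr (_ + _).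
  under eq_bigr do rewrite mulrC.
  by rewrite up_down_adjoint; apply: eq_bigr => B _; rewrite expr2.
by rewrite /sqnorm mulr_sumr; apply: eq_bigr => A _; ring.
Qed.

(* For m > 0 this includes orthogonality to constants, as the coordinates sum
   to m on the slice. *)
Definition orth1 m h := forall i, \sum_(A in ksets n m) h A * (i \in A)%:R = 0.

Lemma sum_mem_card m A : A \in ksets n m -> \sum_i (i \in A)%:R = m%:R :> R.
Proof.
by rewrite inE => /eqP <-; rewrite -natr_sum -big_mkcond /= sum1_card.
Qed.

Lemma orth1_sum m h : orth1 m.+1 h -> \sum_(A in ksets n m.+1) h A = 0.
Proof.
move=> oh; apply: (@mulfI _ m.+1%:R); first by rewrite pnatr_eq0.
rewrite mulr0; transitivity (\sum_i \sum_(A in ksets n m.+1) h A * (i \in A)%:R).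
  rewrite exchange_big /= mulr_sumr.
  by apply: eq_bigr => A hA; rewrite -mulr_sumr (sum_mem_card hA) mulrC.
by apply: big1 => i _; apply: oh.
Qed.

(** By adjointness it is enough that [up] sends the coordinate function x_i on level m to m x_i. *)
Lemma orth1_down m h : orth1 m.+1 h -> orth1 m (down h).
Proof.
move=> oh i.
under eq_bigr do rewrite mulrC.
rewrite -up_down_adjoint.
transitivity (\sum_(B in ksets n m.+1) m%:R * (h B * (i \in B)%:R)); last first.
  by rewrite -mulr_sumr oh mulr0.
apply: eq_bigr => B; rewrite inE => /eqP cB.
rewrite mulrC mulrCA; congr (_ * _); rewrite /up.
case: (boolP (i \in B)) => iB; last first.
  by rewrite mulr0 big1 // => x _; rewrite !inE (negbTE iB) andbF.
rewrite mulr1 (bigD1 i) //= !inE eqxx /= add0r.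
transitivity (\sum_(x in B | x != i) 1 : R).
  by apply: eq_bigr => x /andP[_ xi]; rewrite !inE iB eq_sym xi.
rewrite sumr_const; congr (_%:R).
move: cB; rewrite (cardD1 i) iB add1n => -[<-].
by apply: eq_card => x; rewrite !inE andbC.
Qed.

(** Here [down] sends x_i to (n - m - 2) x_i + 1 on level m + 1, and the constant is handled by
    [orth1_sum]. *)
Lemma orth1_up m h : orth1 m.+1 h -> orth1 m.+2 (up h).
Proof.
move=> oh i; rewrite up_down_adjoint.
transitivity (\sum_(A in ksets n m.+1)
    ((n%:R - m.+2%:R) * (h A * (i \in A)%:R) + h A)); last first.
  by rewrite big_split /= -mulr_sumr oh mulr0 orth1_sum // addr0.
apply: eq_bigr => A; rewrite inE => /eqP cA.
have cC : #|~: A| = (n - m.+1)%N by rewrite cardsCs setCK cA card_ord.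
have mn : (m.+1 <= n)%N by rewrite -cA -[n in (_ <= n)%N]card_ord max_card.
rewrite /down; case: (boolP (i \in A)) => iA.
  transitivity (h A * (n - m.+1)%:R); last first.
    by rewrite natrB // -[m.+2%:R]natr1 /= mulr1; ring.
  rewrite -cC -sum1_card natr_sum; congr (_ * _); apply: eq_bigr => x _.
  by rewrite !inE iA orbT.
rewrite (bigD1 i) /= ?inE // eqxx big1 ?addr0; first by rewrite !mulr0 add0r mulr1.
by move=> x /andP[_ xi]; rewrite !inE (negbTE iA) orbF eq_sym (negbTE xi).
Qed.

(* [down] has the same norm on level m as [up] on level m - 1, and the commutator
   relation bounds the latter by the norm of [down] on level m - 1. *)
Lemma sqnorm_down_le j h : (j.+4 <= n)%N -> orth1 j.+2 h ->
  sqnorm j.+1 (down h) <= j%:R * (n%:R - j%:R - 3) * sqnorm j.+2 h.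
Proof.
elim: j h => [|j IH] h jn oh.
  rewrite !mul0r /sqnorm big1 // => A; rewrite inE => /cards1P[i ->].
  (* On level 1 the coordinate functions are the indicators of points, so orthogonality makes
     [down h] vanish there. *)
  have <- : \sum_(A in ksets n 1) down h A * (i \in A)%:R = down h [set i]%SET.
    rewrite (bigD1 [set i]%SET) ?inE ?cards1 //= eqxx mulr1 big1 ?addr0 //.
    move=> B; rewrite inE => /andP[/cards1P[j ->] ji]; rewrite inE.
    have /negbTE -> : i != j by apply: contraNneq ji => ->.
    by rewrite mulr0.
  by rewrite (orth1_down oh) expr0n.
have od := orth1_down oh.
have {IH} := IH _ (ltnW jn) od.
pose M : R := j.+1%:R * (n%:R - j.+1%:R - 3).
have jn' : j.+1%:R + 4 <= n%:R :> R by rewrite -natrD ler_nat; lia.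
have M0 : 0 < M by rewrite mulr_gt0 ?ltr0n //; lra.
have s0 := sqnorm_ge0 j.+2 (down h).
move=> Hd; have Hu : sqnorm j.+3 (up (down h)) <= M * sqnorm j.+2 (down h).
  rewrite sqnorm_up -lerBrDr; apply: le_trans Hd _.
  by rewrite /M -[j.+2%:R]natr1 -[j.+1%:R]natr1 -subr_ge0 le_eqVlt; apply/orP; left; apply/eqP; ring.
have E : sqnorm j.+2 (down h) = \sum_(A in ksets n j.+3) up (down h) A * h A.
  by rewrite up_down_adjoint; apply: eq_bigr => A _; rewrite expr2.
(* Since |down h|^2 = <up (down h), h>, the inequality 2 M x y <= (M x)^2 + y^2 applies; the bound
   on |up (down h)|^2 then absorbs half of the left side. *)
have H2 : 2 * M * sqnorm j.+2 (down h) <=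
    M ^+ 2 * sqnorm j.+3 h + sqnorm j.+3 (up (down h)).
  rewrite E /sqnorm !mulr_sumr -big_split /=; apply: ler_sum => A _.
  by have := sqr_ge0 (M * h A - up (down h) A); nra.
have {}H2 : M * sqnorm j.+2 (down h) <= M * (M * sqnorm j.+3 h) by nra.
by move: H2; rewrite ler_pM2l.
Qed.

(** The two contributions add up exactly: j (n - j - 3) + (n - 2 (j + 2)) = (j + 1)(n - j - 4), the
    eigenvalue of down after up on functions of pure degree 2. *)
Lemma sqnorm_up_le j h : (j.+4 <= n)%N -> orth1 j.+2 h ->
  sqnorm j.+3 (up h) <= j.+1%:R * (n%:R - j.+4%:R) * sqnorm j.+2 h.
Proof.
move=> jn oh; rewrite sqnorm_up -lerBrDr; apply: le_trans (sqnorm_down_le jn oh) _.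
rewrite -mulrBl; apply: ler_wpM2r; first exact: sqnorm_ge0.
rewrite -!natr1; lra.
Qed.

Lemma orth1_iter_up t m h : orth1 m.+1 h -> orth1 (t + m).+1 (iter t up h).
Proof. by move=> oh; elim: t => //= t IH; apply: orth1_up. Qed.

Lemma sqnorm_iter_up t j h : (t + j.+3 <= n)%N -> orth1 j.+2 h ->
  sqnorm (t + j.+2) (iter t up h) <=
  (\prod_(0 <= s < t) ((s + j).+1%:R * (n%:R - (s + j).+4%:R))) * sqnorm j.+2 h.
Proof.
move=> + oh; elim: t => [|t IH] tn; first by rewrite big_geq // mul1r.
have {}IH := IH (ltnW tn).
rewrite addSn big_nat_recr //= [X in X * _]mulrC -mulrA.
have o : orth1 (t + j).+2 (iter t up h) by rewrite -addnS; apply: orth1_iter_up.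
rewrite !addnS in IH *.
apply: le_trans (sqnorm_up_le _ o) _; first by lia.
apply: ler_wpM2l => //; apply: mulr_ge0 => //.
by rewrite subr_ge0 ler_nat; lia.
Qed.

(** Each k-subset A of B is reached by deleting the t elements of B outside A, in any of t!
    orders. *)
Lemma iter_upE t k h B : #|B| = (t + k)%N ->
  iter t up h B = t`!%:R * \sum_(A in ksets n k | A \subset B) h A.
Proof.
elim: t B => [|t IH] B cB.
  rewrite mul1r (big_pred1 B) // => A; rewrite !inE [RHS]eqEcard cB andbC.
  case: (boolP (A \subset B)) => //= /subset_leq_card; rewrite cB eqn_leq.
  by move=> ->.
rewrite iterS /up.
transitivity (\sum_(x in B) t`!%:R * \sum_(A in ksets n k | A \subset B :\ x) h A).
  apply: eq_bigr => x xB; apply: IH.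
  by move: cB; rewrite (cardsD1 x) xB addSn => -[].
rewrite -mulr_sumr factS natrM [t.+1%:R * _]mulrC -mulrA; congr (_ * _).
rewrite (exchange_big_dep (fun A => (A \in ksets n k) && (A \subset B))) /=; last first.
  by move=> x A xB /andP[-> sA]; rewrite (subset_trans sA) // subsetDl.
rewrite mulr_sumr; apply: eq_bigr => A /andP[]; rewrite inE => /eqP cA sAB.
rewrite (eq_bigl [in B :\: A]) => [|x].
  rewrite sumr_const cardsD (setIidPr sAB) cB cA.
  by rewrite addnK mulr_natl.
rewrite !inE cA eqxx subsetD1 sAB /= andbC.
by [].
Qed.

End UpDown.

(** * The Kneser operator *)

Section Kneser.
Variables (R : realFieldType) (n : nat).
Implicit Types (h g : {set 'I_n} -> R) (A B C : {set 'I_n}).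

Definition kneser k h A : R := \sum_(B in ksets n k | B \subset ~: A) h B.

Lemma sum_ksetsC k (F : {set 'I_n} -> R) : (k <= n)%N ->
  \sum_(A in ksets n k) F (~: A) = \sum_(B in ksets n (n - k)) F B.
Proof.
move=> kn; rewrite [RHS](reindex_inj (@setC_inj _)) /=; apply: eq_bigl => A.
rewrite !inE [in RHS]cardsCs setCK card_ord.
have : (#|A| <= n)%N by rewrite -[n in (_ <= n)%N]card_ord max_card.
lia.
Qed.

(** With n = t + 2j + 4 both families of factors run through j + 1, ..., j + t, one upwards and one
    downwards, so each product is (t + j)! / j!. *)
Lemma prod_up_factors t j :
  \prod_(0 <= s < t) ((s + j).+1%:R * ((t + j.*2 + 4)%N%:R - (s + j).+4%:R)) =
  (t`! * 'C(t + j, j))%N%:R ^+ 2 :> R.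
Proof.
rewrite big_split /= expr2.
have -> : (t`! * 'C(t + j, j))%N = ((t + j) ^_ t)%N.
  by rewrite -bin_ffact mulnC -[in RHS]bin_sub ?leq_addr // addKn.
rewrite ffact_prod natr_prod; congr (_ * _).
  rewrite big_nat_rev /= big_mkord; apply: eq_bigr => i _.
  by congr _%:R; have := ltn_ord i; lia.
rewrite big_mkord; apply: eq_bigr => i _.
by have it := ltn_ord i; rewrite -natrB; [congr _%:R|]; lia.
Qed.

(** With t = n - 2k, applying [up] t times leads from level k to level n - k; its value at the
    complement of A is t! times the Kneser operator at A. The constant is the absolute value of the
    degree-2 Kneser eigenvalue. *)
Lemma sqnorm_kneser_le j h : (j.+2.*2 <= n)%N -> orth1 j.+2 h ->
  sqnorm j.+2 (kneser j.+2 h) <= 'C(n - j.+4, j)%:R ^+ 2 * sqnorm j.+2 h.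
Proof.
move=> jn oh; set k := j.+2; pose t := (n - k.*2)%N.
have En : n = (t + j.*2 + 4)%N by rewrite /t /k; lia.
have ub := sqnorm_iter_up (_ : (t + j.+3 <= n)%N) oh.
have {}ub := ub ltac:(lia).
have E : sqnorm (t + k) (iter t (@up R n) h) = t`!%:R ^+ 2 * sqnorm k (kneser k h).
  rewrite /sqnorm /kneser.
  rewrite (sum_ksetsC (fun E => (\sum_(B in ksets n k | B \subset E) h B) ^+ 2)); last by lia.
  have -> : (n - k = t + k)%N by rewrite /t /k; lia.
  rewrite mulr_sumr; apply: eq_bigr => B; rewrite inE => /eqP cB.
  by rewrite (iter_upE _ cB) exprMn.
have {ub} : t`!%:R ^+ 2 * sqnorm k (kneser k h) <=
    (t`! * 'C(t + j, j))%N%:R ^+ 2 * sqnorm k h.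
  rewrite -E -prod_up_factors; apply: le_trans ub _; rewrite le_eqVlt; apply/orP; left.
  apply/eqP; congr (_ * _); apply: eq_bigr => s _; congr (_ * (_%:R - _)); lia.
rewrite natrM exprMn -[_ * sqnorm k h]mulrA ler_pM2l; last by rewrite exprn_gt0 // ltr0n fact_gt0.
by rewrite (_ : n - j.+4 = t + j)%N //; lia.
Qed.

Lemma kneser_self_adjoint k h g :
  \sum_(A in ksets n k) g A * kneser k h A =
  \sum_(A in ksets n k) kneser k g A * h A.
Proof.
rewrite /kneser.
under eq_bigr do rewrite mulr_sumr.
under [RHS]eq_bigr do rewrite mulr_suml.
rewrite (exchange_big_dep [in ksets n k]) /=; last by move=> A B _ /andP[].
apply: eq_bigr => B hB; apply: eq_bigl => A.
by rewrite hB /=; congr (_ && _); rewrite -disjoints_subset disjoint_sym disjoints_subset.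
Qed.

Lemma card_ksubsets k B : #|[set A in ksets n k | A \subset B]%SET| = 'C(#|B|, k).
Proof. by rewrite -cards_draws; apply: eq_card => A; rewrite !inE andbC. Qed.

Lemma kneser_const k (c : R) A : A \in ksets n k ->
  kneser k (fun=> c) A = 'C(n - k, k)%:R * c.
Proof.
rewrite inE => /eqP cA; rewrite /kneser.
have cC : #|~: A| = (n - k)%N by rewrite cardsCs setCK card_ord cA.
rewrite (eq_bigl [in [set B in ksets n k | B \subset ~: A]%SET]); last first.
  by move=> B; rewrite !inE.
by rewrite sumr_const card_ksubsets cC mulr_natl.
Qed.

Lemma card_ksupersets k C : (k <= n)%N ->
  #|[set A in ksets n k | C \subset A]%SET| = 'C(n - #|C|, n - k).
Proof.
move=> kn; have -> : (n - #|C|)%N = #|~: C| by rewrite [RHS]cardsCs setCK card_ord.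
rewrite -card_ksubsets -(card_imset _ (@setC_inj _)); apply: eq_card => A.
rewrite -[A]setCK mem_imset; last exact: setC_inj.
rewrite !inE setCS [in RHS]cardsCs setCK card_ord; congr (_ && _).
have : (#|~: A| <= n)%N by rewrite -[n in (_ <= n)%N]card_ord max_card.
lia.
Qed.

(** For i outside A, Pascal's rule counts the subsets of the complement through i as all subsets
    less those avoiding i. *)
Lemma kneser_mem k A i : A \in ksets n k.+1 ->
  kneser k.+1 (fun B => (i \in B)%:R) A =
  'C((n - k.+1).-1, k)%:R * (1 - (i \in A)%:R).
Proof.
rewrite inE => /eqP cA; rewrite /kneser.
have cC : #|~: A| = (n - k.+1)%N by rewrite cardsCs setCK card_ord cA.
case: (boolP (i \in A)) => iA.
  rewrite subrr mulr0 big1 // => B /andP[_ /fintype.subsetP sB].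
  by case: (boolP (i \in B)) => // /sB; rewrite inE iA.
rewrite subr0 mulr1; pose D := ~: A :\ i.
have cD : #|~: A| = #|D|.+1 by rewrite (cardsD1 i) inE iA.
rewrite -cC cD /=; apply: (@addrI _ 'C(#|D|, k.+1)%:R).
rewrite -[RHS]natrD -binS -cD -!card_ksubsets -!sum1_card !natr_sum.
rewrite (big_mkcond [in [set B in ksets n k.+1 | B \subset D]%SET]) /=.
rewrite [X in _ + X](eq_bigl [in [set B in ksets n k.+1 | B \subset ~: A]%SET]); last first.
  by move=> B; rewrite !inE.
rewrite [in RHS]big_mkcond /= [X in _ + X]big_mkcond -big_split /=.
apply: eq_bigr => B _; rewrite !inE /D subsetD1.
by case: (#|B| == _); case: (B \subset _); case: (i \in B); rewrite /= ?addr0 ?add0r.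
Qed.
End Kneser.

(** * Moments of linear forms on a slice *)

Section Moments.
Variables (R : realFieldType) (n k : nat) (a : 'I_n -> R).
Hypothesis kn : (k <= n)%N.
Hypothesis sum_a0 : \sum_i a i = 0.
Implicit Types (A B C I : {set 'I_n}).

(* The number of k-sets containing a fixed j-set. *)
Definition ncontain j : R := 'C(n - j, n - k)%:R.
Notation c := ncontain.

Definition linform A : R := \sum_i a i * (i \in A)%:R.
Notation G := linform.

Definition psum j : R := \sum_i a i ^+ j.

Lemma sum_contain I : \sum_(A in ksets n k) (I \subset A)%:R = c #|I|.
Proof.
rewrite /ncontain -card_ksupersets // -sum1_card natr_sum.
rewrite big_mkcond [RHS]big_mkcond; apply: eq_bigr => A _; rewrite !inE.
by case: ifP => //=; case: ifP.
Qed.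

(** Expanding one factor [G A] adds an element to the set that A must contain, so moments are
    computed one power at a time. *)
Lemma sum_contain_linform I (F : {set 'I_n} -> R) :
  \sum_(A in ksets n k) (I \subset A)%:R * (G A * F A) =
  \sum_i a i * \sum_(A in ksets n k) (i |: I \subset A)%:R * F A.
Proof.
under eq_bigr do rewrite mulr_suml mulr_sumr.
rewrite exchange_big /=; apply: eq_bigr => i _; rewrite mulr_sumr.
apply: eq_bigr => A _; rewrite subUset sub1set -mulnb natrM; ring.
Qed.

Lemma sum_split_mem I (x y : R) :
  \sum_i a i * (if i \in I then x else y) = (x - y) * \sum_(i in I) a i.
Proof.
transitivity (\sum_i (a i * y + (if i \in I then (x - y) * a i else 0))).
  by apply: eq_bigr => i _; case: ifP => _; ring.
by rewrite big_split /= -mulr_suml sum_a0 mul0r add0r -big_mkcond mulr_sumr.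
Qed.

Lemma moment1_contain I :
  \sum_(A in ksets n k) (I \subset A)%:R * G A =
  (c #|I| - c #|I|.+1) * \sum_(i in I) a i.
Proof.
under eq_bigr do rewrite -[G _]mulr1.
rewrite sum_contain_linform -sum_split_mem //; apply: eq_bigr => i _.
congr (_ * _); under eq_bigr do rewrite mulr1.
by rewrite sum_contain cardsU1; case: (i \in I).
Qed.

Lemma moment2_contain I :
  \sum_(A in ksets n k) (I \subset A)%:R * G A ^+ 2 =
  (c #|I| - 2 * c #|I|.+1 + c #|I|.+2) * (\sum_(i in I) a i) ^+ 2
  + (c #|I|.+1 - c #|I|.+2) * (psum 2 - \sum_(i in I) a i ^+ 2).
Proof.
under eq_bigr do rewrite expr2.
rewrite sum_contain_linform.
under eq_bigr do rewrite moment1_contain.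
set s := \sum_(i in I) a i; set s2 := \sum_(i in I) _; set m := #|I|.
(* The size of i |: I depends on whether i is in I: the value for i outside I is summed over all i
   and corrected on I. *)
transitivity (\sum_i (a i * (c m.+1 - c m.+2) * s +
    ((c m.+1 - c m.+2) * a i ^+ 2 + (if i \in I then
     a i * ((c m - c m.+1) * s - (c m.+1 - c m.+2) * s)
     - (c m.+1 - c m.+2) * a i ^+ 2 else 0)))).
  apply: eq_bigr => i _; rewrite cardsU1.
  case: (boolP (i \in I)) => iI /=.
    have -> : i |: I = I by apply/setUidPr; rewrite sub1set.
    rewrite add0n -/m -/s; ring.
  rewrite big_setU1 //= -/s add1n -/m; ring.
rewrite !big_split /= -!mulr_suml sum_a0 !mul0r add0r -mulr_sumr -/(psum 2).
rewrite -big_mkcond big_split /= -mulr_suml -/s sumrN -mulr_sumr -/s2; ring.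
Qed.

Lemma moment1 : \sum_(A in ksets n k) G A = 0.
Proof.
transitivity (\sum_(A in ksets n k) (finset.set0 \subset A)%:R * G A).
  by apply: eq_bigr => A _; rewrite sub0set mul1r.
by rewrite moment1_contain big_set0 mulr0.
Qed.

Lemma moment1_mem i :
  \sum_(A in ksets n k) G A * (i \in A)%:R = (c 1 - c 2) * a i.
Proof.
have := moment1_contain [set i]%SET; rewrite big_set1 cards1 => <-.
by apply: eq_bigr => A _; rewrite sub1set mulrC.
Qed.

Lemma moment2 : \sum_(A in ksets n k) G A ^+ 2 = (c 1 - c 2) * psum 2.
Proof.
transitivity (\sum_(A in ksets n k) (finset.set0 \subset A)%:R * G A ^+ 2).
  by apply: eq_bigr => A _; rewrite sub0set mul1r.
rewrite moment2_contain !big_set0 cards0; ring.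
Qed.

Lemma moment3 :
  \sum_(A in ksets n k) G A ^+ 3 = (c 1 - 3 * c 2 + 2 * c 3) * psum 3.
Proof.
transitivity (\sum_i a i * \sum_(A in ksets n k) (i |: finset.set0 \subset A)%:R * G A ^+ 2).
  rewrite -sum_contain_linform; apply: eq_bigr => A _.
  by rewrite sub0set mul1r exprS.
transitivity (\sum_i ((c 1 - 3 * c 2 + 2 * c 3) * a i ^+ 3 + a i * ((c 2 - c 3) * psum 2))).
  apply: eq_bigr => i _; rewrite setU0 moment2_contain cards1 !big_set1; ring.
by rewrite big_split /= -mulr_suml sum_a0 mul0r addr0 -mulr_sumr.
Qed.

Lemma moment4 :
  \sum_(A in ksets n k) G A ^+ 4 =
  (c 1 - 7 * c 2 + 12 * c 3 - 6 * c 4) * psum 4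
  + 3 * (c 2 - 2 * c 3 + c 4) * psum 2 ^+ 2.
Proof.
pose q i l := \sum_(A in ksets n k) (l |: (i |: finset.set0) \subset A)%:R * G A ^+ 2.
transitivity (\sum_i a i * \sum_l a l * q i l).
  transitivity (\sum_i a i * \sum_(A in ksets n k) (i |: finset.set0 \subset A)%:R * (G A * G A ^+ 2)).
    rewrite -sum_contain_linform; apply: eq_bigr => A _.
    by rewrite sub0set mul1r !exprS.
  by apply: eq_bigr => i _; rewrite sum_contain_linform.
pose al : R := c 2 - 2 * c 3 + c 4; pose be : R := c 3 - c 4.
pose d i := (c 1 - 3 * c 2 + 2 * c 3) * a i ^+ 2 + (c 2 - c 3) * psum 2.
(* The formula for distinct indices is extended to l = i with a diagonal correction, so that the
   double sum splits into power sums. *)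
have qE i l : q i l = al * (a i + a l) ^+ 2 + be * (psum 2 - a i ^+ 2 - a l ^+ 2)
   + (if l == i then d i - al * (a i + a i) ^+ 2 - be * (psum 2 - a i ^+ 2 - a i ^+ 2) else 0).
  rewrite /q setU0; case: (eqVneq l i) => [->|li].
    rewrite setUid moment2_contain cards1 !big_set1 /d; ring.
  rewrite moment2_contain cardsU1 inE (negbTE li) cards1 /=.
  rewrite !big_setU1 ?inE //= !big_set1 /al /be; ring.
(* Each factor 0 stands for the sum of all [a l]. *)
transitivity (\sum_i (a i * (al * (a i ^+ 2 * 0 + 2 * a i * psum 2 + psum 3)
   + be * (psum 2 * 0 - a i ^+ 2 * 0 - psum 3))
   + a i ^+ 2 * (d i - al * (a i + a i) ^+ 2 - be * (psum 2 - a i ^+ 2 - a i ^+ 2)))).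
  apply: eq_bigr => i _.
  transitivity (a i * \sum_l (((al - be) * a i ^+ 2 + be * psum 2) * a l + 2 * al * a i * a l ^+ 2 + (al - be) * a l ^+ 3
     + (if l == i then a i * (d i - al * (a i + a i) ^+ 2 - be * (psum 2 - a i ^+ 2 - a i ^+ 2)) else 0))).
    congr (_ * _); apply: eq_bigr => l _; rewrite qE.
    by case: eqVneq => [->|_]; ring.
  rewrite !big_split /= -!mulr_sumr sum_a0 -/(psum 2) -/(psum 3).
  rewrite -big_mkcond big_pred1_eq; ring.
transitivity (\sum_i ((2 * al - be + (c 2 - c 3)) * psum 2 * a i ^+ 2
  + (c 1 - 3 * c 2 + 2 * c 3 - 4 * al + 2 * be) * a i ^+ 4 + (al - be) * psum 3 * a i)).
  by apply: eq_bigr => i _; rewrite /d; ring.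
rewrite !big_split /= -!mulr_sumr sum_a0 -/(psum 2) -/(psum 4) /al /be; ring.
Qed.

Lemma psum4_le : psum 4 <= psum 2 ^+ 2.
Proof.
rewrite /psum expr2 mulr_sumr; apply: ler_sum => i _.
rewrite mulrC mulr_sumr (bigD1 i) //= -[leLHS]addr0 lerD //.
  by rewrite -exprD.
by apply: sumr_ge0 => l _; rewrite mulr_ge0 // sqr_ge0.
Qed.

Lemma ncontain_ge0 j : 0 <= c j. Proof. exact: ler0n. Qed.

Lemma ncontain_decr j : c j.+1 <= c j.
Proof. by rewrite ler_nat leq_bin2l //; lia. Qed.

Lemma ncontain0 : c 0 = 'C(n, k)%:R.
Proof. by rewrite /c subn0 bin_sub. Qed.

Lemma ncontain_rec j : (j < k)%N ->
  (n%:R - j%:R) * c j.+1 = (k%:R - j%:R) * c j.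
Proof.
move=> jk; rewrite /c -!natrB; [|lia|lia]; rewrite -!natrM; congr _%:R.
have -> : (k - j = n - j - (n - k))%N by lia.
by rewrite -mul_bin_down subnS.
Qed.

(** As [c] decreases, dropping negative terms bounds the coefficients by (1 + 12) c 1 and 3 (1 + 1)
    c 1; then [psum4_le] merges them into 19 c 1. *)
Lemma moment4_le :
  \sum_(A in ksets n k) G A ^+ 4 <= 19 * c 1 * psum 2 ^+ 2.
Proof.
rewrite moment4.
have := psum4_le; have := ncontain_decr 1; have := ncontain_decr 2.
have := ncontain_decr 3; have := ncontain_ge0 4 => h4 h3 h2 h1 h.
have p4 : 0 <= psum 4 by apply: sumr_ge0 => i _; rewrite (exprM _ 2 2) sqr_ge0.
have p2 : 0 <= psum 2 ^+ 2 by apply: sqr_ge0.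
have b1 : (c 1 - 7 * c 2 + 12 * c 3 - 6 * c 4) * psum 4 <= 13 * c 1 * psum 4.
  by apply: ler_wpM2r => //; lra.
have b2 : 3 * (c 2 - 2 * c 3 + c 4) * psum 2 ^+ 2 <= 6 * c 1 * psum 2 ^+ 2.
  by apply: ler_wpM2r => //; lra.
have b3 : 13 * c 1 * psum 4 <= 13 * c 1 * psum 2 ^+ 2.
  by apply: ler_wpM2l => //; lra.
by apply: le_trans (lerD (le_trans b1 b3) b2) _; lra.
Qed.

End Moments.

(** * Numerical estimates *)

(** Provides products of two inequalities as hypotheses for [lra]. *)
Lemma mulr_subs_ge0 (R : realDomainType) (a b c d : R) :
  a <= b -> c <= d -> 0 <= (b - a) * (d - c).
Proof. by move=> ab cd; rewrite mulr_ge0 // subr_ge0. Qed.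

(** [Vs] and [w] are the normalized squared norms of the linear part and of the remainder.
    Eliminating [Vs] gives mu (mu - ka) + w ka (1 - 2 ka) <= theta; as mu is not much below ka, both
    w and mu - ka are of order theta. *)
Lemma spectral_numerics (R : realFieldType) (beta ka mu w Vs theta : R) :
  0 < beta -> beta < 1 / 4 -> 0 <= theta -> theta <= beta ^+ 2 / 32 ->
  beta <= ka -> ka <= 1 / 2 - beta ->
  let r := ka / (1 - ka) in
  (1 - theta) * ka <= mu -> mu <= 1 -> 0 <= w ->
  mu = mu ^+ 2 + Vs + w ->
  mu ^+ 2 - r * Vs - r ^+ 2 * w <= theta ->
  [/\ w * beta ^+ 2 <= theta, (mu - ka) * beta <= 2 * theta,
      ka / 2 <= mu & mu <= 1 / 2].
Proof.
move=> b0 b4 th0 th2 kb kb' r muge mu1 w0 EV.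
have E1 : Vs = mu - mu ^+ 2 - w by lra.
rewrite {}E1 {Vs EV} => En; have b0' := ltW b0.
have b2b : beta ^+ 2 <= beta / 4 by have := mulr_subs_ge0 b0' (ltW b4); lra.
have k0 : 0 < ka by lra.
have k1 : 0 < 1 - ka by lra.
have k2 : 0 <= 1 - 2 * ka by lra.
have muh : ka / 2 <= mu.
  have h : theta <= 1 / 2 by lra.
  by have := mulr_subs_ge0 h (ltW k0); lra.
have E2 : mu * (mu - ka) + w * (ka * (1 - 2 * ka)) <= theta.
  have rE : r * (1 - ka) = ka by rewrite /r mulfVK // gt_eqF.
  have r12 : 1 - 2 * ka <= 1 - r.
    rewrite lerBrDl -lerBrDr /r ler_pdivrMr //.
    by have := mulr_subs_ge0 (ltW k0) k2; lra.
  have H2 : 0 <= w * ka * (1 - r - (1 - 2 * ka)).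
    by rewrite !mulr_ge0 ?subr_ge0 // ltW.
  have H3 : 0 <= (theta - (mu ^+ 2 - r * (mu - mu ^+ 2 - w) - r ^+ 2 * w)) * (1 - ka).
    by apply: mulr_ge0; [rewrite subr_ge0 | exact: ltW].
  have H4 := mulr_ge0 th0 (ltW k0).
  have E : (theta - (mu ^+ 2 - r * (mu - mu ^+ 2 - w) - r ^+ 2 * w)) * (1 - ka) =
     theta - theta * ka - mu ^+ 2 * (1 - ka)
     + r * (1 - ka) * (mu - mu ^+ 2 - w) + r * (1 - ka) * r * w by ring.
  rewrite {}E rE in H3; lra.
have kk2 : 2 * beta ^+ 2 <= ka * (1 - 2 * ka).
  have h : 2 * beta <= 1 - 2 * ka by lra.
  by have := mulr_subs_ge0 (ltW k0) h; have := mulr_subs_ge0 b0' kb; lra.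
have kk2' := mulr_ge0 (ltW k0) k2.
have mu0 : 0 <= mu by lra.
have mk : mu * (ka - mu) <= theta.
  have h : ka - mu <= theta * ka by lra.
  have h1 : mu * ka <= 1 by have := mulr_subs_ge0 mu1 (ltW k0); lra.
  by have := mulr_subs_ge0 mu0 h; have := mulr_subs_ge0 th0 h1; lra.
have wle : w * beta ^+ 2 <= theta by have := mulr_subs_ge0 w0 kk2; lra.
have muk : (mu - ka) * beta <= 2 * theta.
  have h := mulr_ge0 w0 kk2'.
  have [H|H] := leP mu ka; first by have := mulr_subs_ge0 H b0'; lra.
  have h1 : beta / 2 <= mu by lra.
  by have := mulr_subs_ge0 (ltW H) h1; lra.
have mub : mu - ka <= beta by rewrite -(ler_pM2r b0); lra.
by split => //; lra.
Qed.

(** Each summand is at most half of the right side: [tau] is chosen small enough for the second, and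
    then [theta] is small against [tau] for the first. *)
Lemma cubic_error_numerics (R : realFieldType) (beta eps ka w Vs s2 theta tau : R) :
  0 < beta -> beta < 1 / 4 -> 0 < eps ->
  tau = eps * beta ^+ 4 / (64 * 64) -> theta = tau * beta ^+ 4 * eps / 32 ->
  0 <= ka -> ka <= 1 / 2 -> Vs <= 1 ->
  0 <= s2 -> s2 * beta <= 2 -> w * beta ^+ 2 <= theta ->
  w / (2 * tau) + 3 * tau / 2 * (1 + Vs + 19 * ka * s2 ^+ 2) <=
    eps * beta ^+ 2 / 32.
Proof.
move=> b0 b4 e0 tauE thE k0 k1 Vs1 s20 s2b wle.
have b20 : 0 < beta ^+ 2 by rewrite exprn_gt0.
have b2b : beta ^+ 2 <= 1 / 16 by have := mulr_subs_ge0 (ltW b0) (ltW b4); lra.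
have tau0 : 0 < tau by rewrite tauE divr_gt0 ?mulr_gt0 ?exprn_gt0.
have s2b2 : s2 ^+ 2 * beta ^+ 2 <= 4.
  have -> : 4 = 2 ^+ 2 :> R by ring.
  by rewrite -exprMn ler_sqr ?nnegrE //; rewrite mulr_ge0 // ltW.
have A1 : w / (2 * tau) <= eps * beta ^+ 2 / 64.
  rewrite ler_pdivrMr ?mulr_gt0 // -(ler_pM2r b20); apply: le_trans wle _.
  by rewrite thE; lra.
have A2 : 3 * tau / 2 * (1 + Vs + 19 * ka * s2 ^+ 2) <= eps * beta ^+ 2 / 64.
  have sq0 : 0 <= s2 ^+ 2 * beta ^+ 2 by rewrite mulr_ge0 // sqr_ge0.
  have B1 : beta ^+ 2 * (1 + Vs + 19 * ka * s2 ^+ 2) <= 41.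
    have B2 : ka * (s2 ^+ 2 * beta ^+ 2) <= 1 / 2 * 4 by apply: ler_pM.
    by have := mulr_subs_ge0 (ltW b20) Vs1; lra.
  rewrite -(ler_pM2r b20).
  have H : 0 <= 3 * tau / 2 * (41 - beta ^+ 2 * (1 + Vs + 19 * ka * s2 ^+ 2)).
    by apply: mulr_ge0; lra.
  have : 0 < eps * beta ^+ 2 * beta ^+ 2 by rewrite !mulr_gt0.
  have : tau = eps * beta ^+ 2 * beta ^+ 2 / (64 * 64) by rewrite tauE; ring.
  by lra.
by lra.
Qed.

(* Here V and c are the normalized coefficients in the second and third moments
   of the linear part. *)
Lemma dictator_numerics (R : realFieldType) (beta eps nn ka mu w s2 s3 ai theta tau : R) :
  0 < beta -> beta < 1 / 4 -> 0 < eps -> eps <= 1 ->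
  tau = eps * beta ^+ 4 / (64 * 64) -> theta = tau * beta ^+ 4 * eps / 32 ->
  8 <= eps * nn -> 2 < nn ->
  beta <= ka -> ka <= 1 / 2 - beta ->
  let r := ka / (1 - ka) in
  let V := ka * (1 - ka) * (nn / (nn - 1)) in
  let c := V * (1 - 2 * ka) * (nn / (nn - 2)) in
  (1 - theta) * ka <= mu -> mu <= 1 -> 0 <= w -> 0 <= s2 ->
  mu = mu ^+ 2 + V * s2 + w ->
  mu ^+ 2 - r * (V * s2) - r ^+ 2 * w <= theta ->
  mu * (1 - mu) * (1 - 2 * mu) - c * s3 <=
    w / (2 * tau) + 3 * tau / 2 * (1 + V * s2 + 19 * ka * s2 ^+ 2) ->
  s3 <= ai * s2 ->
  mu - ka * mu - V * ai <= eps * ka.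
Proof.
move=> b0 b4 e0 e1 tauE thE en n2 kb kb' r V c muge mu1 w0 s20 EV En Cu s3le.
have [b0' e0'] := (ltW b0, ltW e0).
have th0 : 0 <= theta by rewrite thE tauE divr_ge0 // !mulr_ge0 ?invr_ge0 ?exprn_ge0.
have th1 : theta <= eps * beta ^+ 2 / 32.
  rewrite thE tauE ler_pM2r ?invr_gt0 // mulrC ler_pM2l //.
  have b1 j : beta ^+ j <= 1 by apply: exprn_ile1 => //; clear -b4; lra.
  rewrite (_ : 4 = 2 + 2)%N // exprD mulrA ler_piMl ?exprn_ge0 //.
  apply: mulr_ile1 => //; rewrite ?mulr_ge0 ?invr_ge0 ?exprn_ge0 //.
  rewrite ler_pdivrMr // mul1r; apply: (@le_trans _ _ 1); last by clear; lra.
  by apply: mulr_ile1; rewrite -?exprD ?exprn_ge0.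
have th2 : theta <= beta ^+ 2 / 32.
  by apply: le_trans th1 _; rewrite ler_pM2r ?invr_gt0 // ler_piMl ?exprn_ge0.
have [wle muk muh mu2] := spectral_numerics b0 b4 th0 th2 kb kb' muge mu1 w0 EV En.
have k0 : 0 < ka by apply: lt_le_trans kb.
have k1 : 1 / 2 <= 1 - ka by clear -kb' b0; lra.
have k2 : 2 * beta <= 1 - 2 * ka by clear -kb'; lra.
have k2' : 0 <= 1 - 2 * ka by clear -k2 b0; lra.
have n1 : 1 <= nn / (nn - 1) by clear -n2; rewrite ler_pdivlMr; lra.
have Vge : ka * (1 - ka) <= V.
  by rewrite /V ler_peMr // mulr_ge0 //; [exact: ltW | clear -k1; lra].
have Vb : beta / 2 <= V.
  by apply: le_trans Vge; clear -k0 k1 kb; have := mulr_subs_ge0 (ltW k0) k1; lra.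
have nn2 : 0 <= nn / (nn - 2) by clear -n2; rewrite divr_ge0 //; lra.
have V0 : 0 <= V by clear -Vb b0; lra.
have c0 : 0 <= c by apply: mulr_ge0 => //; apply: mulr_ge0.
have Vs : V * s2 <= mu * (1 - mu) by clear -EV w0; lra.
clearbody V r => {En n1}.
have Vs1 : V * s2 <= 1 by clear -Vs muh mu2 k0; have := sqr_ge0 mu; lra.
have s2b : s2 * beta <= 2 by clear -Vb s20 Vs1; have := mulr_subs_ge0 Vb s20; lra.
have khalf : ka <= 1 / 2 by clear -kb' b0; lra.
have err := cubic_error_numerics b0 b4 e0 tauE thE (ltW k0) khalf Vs1 s20 s2b wle.
have Cs : mu * (1 - mu) * (1 - 2 * mu) <= c * s3 + eps * beta ^+ 2 / 32.
  by rewrite -lerBlDl; apply: le_trans Cu err.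
have mb : mu - ka <= eps * beta / 16.
  by rewrite -(ler_pM2r b0); clear -muk th1; lra.
(* Otherwise s3 <= ai s2 keeps c s3 below (1 - 2 ka)(1 - eps / 4) mu (1 - mu), whereas the cubic
   comparison with mu close to ka requires nearly (1 - 2 ka) mu (1 - mu). *)
have aige : 1 - eps / 2 <= ai.
  clear Cu err tauE thE th0 th1 th2 wle muk muge.
  rewrite leNgt; apply/negP => ailt.
  have S3 : c * s3 <= c * ((1 - eps / 2) * s2).
    apply: ler_wpM2l => //; apply: le_trans s3le _.
    by apply: ler_wpM2r => //; exact: ltW.
  have S4 : c * ((1 - eps / 2) * s2) <= (1 - 2 * ka) * (1 - eps / 4) * (mu * (1 - mu)).
    (* The factor nn / (nn - 2) costs half of the gain eps / 2, which is where 8 <= eps nn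
       enters. *)
    have n3 : (1 - eps / 2) * (nn / (nn - 2)) <= 1 - eps / 4.
      by clear -en n2 e0 e1; rewrite mulrA ler_pdivrMr; lra.
    have -> : c * ((1 - eps / 2) * s2) = (1 - 2 * ka) * ((1 - eps / 2) * (nn / (nn - 2))) * (V * s2).
      by rewrite /c; ring.
    have q0 : 0 <= (1 - eps / 2) * (nn / (nn - 2)).
      by rewrite mulr_ge0 //; clear -e1 e0; lra.
    apply: ler_pM => //.
    - by rewrite mulr_ge0.
    - by rewrite mulr_ge0.
    - by apply: ler_wpM2l.
  have {s3le S3 S4}Cs : mu * (1 - mu) * (1 - 2 * mu) <=
      (1 - 2 * ka) * (1 - eps / 4) * (mu * (1 - mu)) + eps * beta ^+ 2 / 32.
    by apply: le_trans Cs _; rewrite lerD2r; apply: le_trans S3 S4.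
  clear -b0 b0' e0 e0' k2 k0 muh mu2 mb Cs kb.
  have e2 := mulr_subs_ge0 e0' k2.
  have mm : beta / 4 <= mu * (1 - mu).
    have h : 1 / 2 <= 1 - mu by lra.
    have mu0 : 0 <= mu by lra.
    by have := mulr_subs_ge0 mu0 h; lra.
  have eb0 : 0 < eps * beta by rewrite mulr_gt0.
  have g : eps * beta / 4 <= (1 - 2 * mu) - (1 - 2 * ka) * (1 - eps / 4) by lra.
  have F : 0 <= mu * (1 - mu) * ((1 - 2 * mu) - (1 - 2 * ka) * (1 - eps / 4) - eps * beta / 4).
    by rewrite mulr_ge0 //; lra.
  have F2 := mulr_subs_ge0 mm (ltW eb0).
  have : 0 < eps * (beta * beta) by rewrite !mulr_gt0.
  by lra.
have ai0 : 0 <= ai by clear -aige e1; lra.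
have Va : ka * (1 - ka) * ai <= V * ai by apply: ler_wpM2r.
clear -Va ai0 aige mb k0 k1 e0' kb b0.
have ek0 := mulr_ge0 e0' (ltW k0).
have L : mu - ka * ai <= eps * ka.
  by have := mulr_subs_ge0 (ltW k0) aige; have := mulr_subs_ge0 e0' kb; lra.
(* Since V >= ka (1 - ka), the left side of the goal is at most (1 - ka)(mu - ka ai). *)
have L2 : (1 - ka) * (mu - ka * ai) <= eps * ka.
  have [H|H] := leP 0 (mu - ka * ai); first by have := mulr_subs_ge0 (ltW k0) H; lra.
  have k1' : 0 <= 1 - ka by lra.
  by have := mulr_subs_ge0 k1' (ltW H); lra.
by lra.
Qed.

(** * Decomposition into affine and orthogonal parts *)

Section Decomposition.
Variables (R : realFieldType) (n k : nat).
Implicit Types (f h : {set 'I_n} -> R) (a : 'I_n -> R) (A B : {set 'I_n}).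

Notation c := (@ncontain R n k).
Notation N := ('C(n, k)%:R : R).
Notation D := ('C(n - k, k)%:R : R).

Definition decomposed f mu a h :=
  [/\ \sum_i a i = 0, orth1 k h, \sum_(A in ksets n k) f A = N * mu &
      forall A, f A = mu + linform a A + h A].

Lemma ncontain1 : (0 < k <= n)%N -> c 1 = N * (k%:R / n%:R).
Proof.
move=> /andP[k0 kn]; have := @ncontain_rec R n k kn 0 k0.
rewrite !subr0 ncontain0 // => E.
by rewrite mulrCA mulrA -E mulrC mulKf // pnatr_eq0; lia.
Qed.

Lemma ncontain2 : (1 < k <= n)%N ->
  c 2 = N * (k%:R / n%:R * ((k%:R - 1) / (n%:R - 1))).
Proof.
move=> /andP[k1 kn]; have := @ncontain_rec R n k kn 1 k1; rewrite ncontain1; last lia.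
have n1 : n%:R - 1 != 0 :> R.
  by rewrite subr_eq0 (eqr_nat R n 1); lia.
have n0 : n%:R != 0 :> R by rewrite pnatr_eq0; lia.
move=> E; apply: (mulfI n1); rewrite E; field.
by rewrite n0 n1.
Qed.

Lemma ncontain3 : (2 < k <= n)%N ->
  c 3 = N * (k%:R / n%:R * ((k%:R - 1) / (n%:R - 1)) * ((k%:R - 2) / (n%:R - 2))).
Proof.
move=> /andP[k1 kn]; have := @ncontain_rec R n k kn 2 k1; rewrite ncontain2; last lia.
have n2 : n%:R - 2 != 0 :> R.
  by rewrite subr_eq0 (eqr_nat R n 2); lia.
have n1 : n%:R - 1 != 0 :> R.
  by rewrite subr_eq0 (eqr_nat R n 1); lia.
have n0 : n%:R != 0 :> R by rewrite pnatr_eq0; lia.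
move=> E; apply: (mulfI n2); rewrite E; field.
by rewrite n0 n1 n2.
Qed.

(** The inner product of mu plus a linear form with x_i is (k/n) N mu + (c 1 - c 2) a_i; solving for
    a_i makes the remainder orthogonal to every x_i. The degree formula is kept to count the members
    that miss i. *)
Lemma decomposition_exists f : (1 < k < n)%N ->
  exists mu a h, decomposed f mu a h /\
    forall i, \sum_(A in ksets n k) f A * (i \in A)%:R =
      k%:R / n%:R * (N * mu) + (c 1 - c 2) * a i.
Proof.
move=> /andP[k1 kn].
have N0 : N != 0 by rewrite pnatr_eq0 -lt0n bin_gt0 ltnW.
have n0 : n%:R != 0 :> R by rewrite pnatr_eq0; lia.
have v0 : c 1 - c 2 != 0.
  rewrite ncontain1 ?ncontain2; [|lia|lia].
  rewrite -mulrBr -[X in X - _]mulr1 -mulrBr mulf_neq0 // mulf_neq0 //.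
    by rewrite mulf_neq0 ?invr_neq0 // pnatr_eq0; lia.
  have n1 : n%:R - 1 != 0 :> R by rewrite subr_eq0 (eqr_nat R n 1); lia.
  rewrite subr_eq0 eq_sym -subr_eq0 -[X in _ - X](divff n1) -mulrBl mulf_neq0 ?invr_neq0 //.
  by rewrite opprB addrA subrK subr_eq0 eqr_nat; lia.
pose M := \sum_(A in ksets n k) f A; pose mu := M / N.
pose d i := \sum_(A in ksets n k) f A * (i \in A)%:R.
pose a i := (d i - k%:R / n%:R * M) / (c 1 - c 2).
have Ed i : d i = k%:R / n%:R * M + (c 1 - c 2) * a i.
  by rewrite /a [(c 1 - c 2) * _]mulrC divfK // addrC subrK.
have a0 : \sum_i a i = 0.
  rewrite -mulr_suml sumrB sumr_const card_ord /d exchange_big /=.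
  have -> : \sum_(A in ksets n k) \sum_i f A * (i \in A)%:R = k%:R * M.
    rewrite mulr_sumr; apply: eq_bigr => A hA.
    by rewrite -mulr_sumr (sum_mem_card R hA) mulrC.
  have -> : k%:R / n%:R * M *+ n = k%:R * M by rewrite -mulr_natl; field.
  by rewrite subrr mul0r.
have NM : N * mu = M by rewrite /mu mulrC divfK.
exists mu, a, (fun A => f A - (mu + linform a A)); split; last by move=> i; rewrite NM -Ed.
split => //; last by move=> A; rewrite addrC subrK.
move=> i; under eq_bigr do rewrite mulrBl mulrDl.
rewrite sumrB big_split /= -/(d i) moment1_mem ?(ltnW kn) // Ed -mulr_sumr.
have -> : \sum_(A in ksets n k) (i \in A)%:R = c 1.
  rewrite -(cards1 i) -sum_contain ?(ltnW kn) //.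
  by apply: eq_bigr => A _; rewrite sub1set.
rewrite ncontain1; last lia.
by rewrite -NM; ring.
Qed.

(** * Quadratic and cubic identities for a decomposed function *)

Section Energy.
Variables (f : {set 'I_n} -> R) (mu : R) (a : 'I_n -> R) (h : {set 'I_n} -> R).
Hypothesis dec : decomposed f mu a h.
Hypothesis k1 : (1 < k)%N.
Hypothesis kn : (k.*2 < n)%N.
Notation G := (linform a).

Let kn' : (k <= n)%N. Proof. by lia. Qed.

Lemma sum_linform_orth1 : \sum_(A in ksets n k) G A * h A = 0.
Proof.
case: dec => _ oh _ _; rewrite /linform.
under eq_bigr do rewrite mulr_suml.
rewrite exchange_big /= big1 // => i _.
transitivity (a i * \sum_(A in ksets n k) h A * (i \in A)%:R).
  by rewrite mulr_sumr; apply: eq_bigr => A _; ring.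
by rewrite oh mulr0.
Qed.

Lemma sum_orth1 : \sum_(A in ksets n k) h A = 0.
Proof.
case: dec => _ oh _ _; have := @orth1_sum R n k.-1 h.
by rewrite prednK; [apply | lia].
Qed.

Lemma card_ksetsE : \sum_(A in ksets n k) 1 = N :> R.
Proof.
rewrite sumr_const; congr _%:R; rewrite /ksets -[in RHS](card_ord n) -card_draws.
by apply: eq_card => A; rewrite !inE.
Qed.

Lemma sum_sqr_decomposed : \sum_(A in ksets n k) f A ^+ 2 =
  N * mu ^+ 2 + (c 1 - c 2) * psum a 2 + sqnorm k h.
Proof.
have [a0 oh _ fE] := dec.
transitivity (\sum_(A in ksets n k) (mu ^+ 2 * 1 + 2 * mu * G A + G A ^+ 2 + 2 * mu * h A
   + 2 * (G A * h A) + h A ^+ 2)).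
  by apply: eq_bigr => A _; rewrite fE; ring.
rewrite !big_split /= -!mulr_sumr card_ksetsE moment1 // moment2 // sum_orth1.
by rewrite sum_linform_orth1 /sqnorm; ring.
Qed.

(** The operator sends x_i to a multiple of 1 - x_i; the constants cancel because the coefficients
    sum to 0. *)
Lemma kneser_linform A : A \in ksets n k ->
  kneser k G A = - (k%:R / (n%:R - k%:R) * D) * G A.
Proof.
have [a0 _ _ _] := dec.
move=> hA; rewrite /kneser /linform exchange_big /=.
have E : k%:R / (n%:R - k%:R) * D = 'C((n - k).-1, k.-1)%:R.
  have := mul_bin_diag (n - k) k.-1; rewrite prednK; last by lia.
  move=> /(congr1 (fun m => m%:R : R)); rewrite !natrM natrB // => E.
  rewrite mulrAC -E mulrAC divff ?mul1r // -natrB // pnatr_eq0; lia.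
transitivity (\sum_i a i * ('C((n - k).-1, k.-1)%:R * (1 - (i \in A)%:R))).
  apply: eq_bigr => i _; rewrite -mulr_sumr; congr (_ * _).
  have := @kneser_mem R n k.-1 A i; rewrite prednK; last by lia.
  by move=> /(_ hA); rewrite /kneser.
rewrite E mulr_sumr; under eq_bigr do rewrite mulrBr mulr1 mulrBr.
rewrite sumrB -mulr_suml a0 mul0r sub0r -sumrN; apply: eq_bigr => i _; ring.
Qed.

(** Constants and the linear part are eigenfunctions, so self-adjointness and orthogonality remove
    all cross terms. *)
Lemma sum_kneser_decomposed : \sum_(A in ksets n k) f A * kneser k f A =
  D * (N * mu ^+ 2 - k%:R / (n%:R - k%:R) * ((c 1 - c 2) * psum a 2))
  + \sum_(A in ksets n k) h A * kneser k h A.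
Proof.
have [a0 oh _ fE] := dec.
set r := k%:R / _.
have KE A : A \in ksets n k -> kneser k f A = D * mu - r * D * G A + kneser k h A.
  move=> hA; rewrite -(kneser_const mu hA) -mulNr -kneser_linform // /kneser -!big_split /=.
  by apply: eq_bigr => B _; rewrite fE.
have K1 : \sum_(A in ksets n k) mu * kneser k h A = 0.
  rewrite kneser_self_adjoint.
  transitivity (\sum_(A in ksets n k) D * mu * h A).
    by apply: eq_bigr => A hA; rewrite kneser_const.
  by rewrite -mulr_sumr sum_orth1 mulr0.
have KG : \sum_(A in ksets n k) G A * kneser k h A = 0.
  rewrite kneser_self_adjoint.
  transitivity (\sum_(A in ksets n k) - (r * D) * (G A * h A)).
    by apply: eq_bigr => A hA; rewrite kneser_linform // mulrA.
  by rewrite -mulr_sumr sum_linform_orth1 mulr0.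
transitivity (\sum_(A in ksets n k) (D * mu ^+ 2 * 1 + (D * mu - r * D * mu) * G A
   - r * D * G A ^+ 2 + D * mu * h A - r * D * (G A * h A)
   + mu * kneser k h A + G A * kneser k h A + h A * kneser k h A)).
  by apply: eq_bigr => A hA; rewrite KE // fE; ring.
rewrite !big_split /= K1 KG !sumrN -!mulr_sumr card_ksetsE moment1 // moment2 //.
by rewrite sum_orth1 sum_linform_orth1; ring.
Qed.

(** With Q the norm bound, 0 <= |Q h + K h|^2 yields <h, K h> >= - Q |h|^2 for the Kneser operator
    K. Moreover Q / D = k (k - 1) / ((n - k)(n - k - 1)) <= (k / (n - k))^2. *)
Lemma sum_kneser_orth1_ge :
  - ((k%:R / (n%:R - k%:R)) ^+ 2 * D * sqnorm k h) <=
  \sum_(A in ksets n k) h A * kneser k h A.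
Proof.
have [_ oh _ _] := dec.
pose j := (k - 2)%N; have kE : k = j.+2 by rewrite /j; lia.
pose Q : R := 'C(n - k.+2, j)%:R.
have Q0 : 0 < Q by rewrite ltr0n bin_gt0; lia.
have jn : (j.+2.*2 <= n)%N by lia.
rewrite kE in oh; have := sqnorm_kneser_le jn oh; rewrite -kE -/Q => HQ.
set X := \sum_(A in _) _.
have H : 0 <= Q ^+ 2 * sqnorm k h + 2 * Q * X + sqnorm k (kneser k h).
  rewrite /sqnorm /X !mulr_sumr -!big_split /=; apply: sumr_ge0 => A _.
  by have := sqr_ge0 (Q * h A + kneser k h A); rewrite sqrrD; lra.
have {H HQ}H : 0 <= 2 * Q * (Q * sqnorm k h + X)  by lra.
have {}H : 0 <= Q * sqnorm k h + X.
  by move: H; rewrite pmulr_rge0 // mulr_gt0.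
have QD : Q <= (k%:R / (n%:R - k%:R)) ^+ 2 * D.
  have m0 : 0 < n%:R - k%:R :> R by rewrite subr_gt0 ltr_nat; lia.
  have e1 : (n - k)%:R * 'C((n - k).-1, k.-1)%:R = k%:R * D :> R.
    by rewrite -!natrM mul_bin_diag prednK //; lia.
  have e2 : (n - k).-1%:R * Q = k.-1%:R * 'C((n - k).-1, k.-1)%:R.
    rewrite /Q -!natrM; have -> : (n - k.+2 = (n - k).-2)%N by lia.
    by rewrite mul_bin_diag kE.
  have m1 : 0 < (n - k).-1%:R :> R by rewrite ltr0n; lia.
  rewrite -(ler_pM2l m1) e2.
  have -> : 'C((n - k).-1, k.-1)%:R = k%:R / (n%:R - k%:R) * D.
    by rewrite mulrAC -e1 natrB // mulrAC divff ?mul1r // gt_eqF.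
  set r := k%:R / _.
  have -> : (n - k).-1%:R * (r ^+ 2 * D) = (n - k).-1%:R * r * (r * D) by ring.
  apply: ler_wpM2r; first by rewrite mulr_ge0 // divr_ge0 // ltW.
  rewrite /r mulrA ler_pdivlMr // -natrB // -!natrM ler_nat; nia.
have := ler_wpM2r (sqnorm_ge0 k h) QD; lra.
Qed.

(** With F = f - mu and g = G, the difference F^3 - g^3 is h Y for Y = F^2 + F g + g^2. A product h
    Y is at most h^2 / (2 tau) + tau Y^2 / 2, and Y^2 <= 3 (1 + g^2 + g^4) because |F| <= 1. *)
Lemma cubic_decomposed tau : 0 < tau ->
  (forall A, f A = 0 \/ f A = 1) -> 0 <= mu <= 1 ->
  N * (mu * (1 - mu) * (1 - 2 * mu)) - (c 1 - 3 * c 2 + 2 * c 3) * psum a 3 <=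
  sqnorm k h / (2 * tau) +
  3 * tau / 2 * (N + (c 1 - c 2) * psum a 2 + 19 * c 1 * psum a 2 ^+ 2).
Proof.
move=> tau0 f01 /andP[mu0 mu1]; have [a0 oh sf fE] := dec.
have -> : N * (mu * (1 - mu) * (1 - 2 * mu)) = \sum_(A in ksets n k) (f A - mu) ^+ 3.
  transitivity (\sum_(A in ksets n k) ((1 - 3 * mu + 3 * mu ^+ 2) * f A - mu ^+ 3 * 1)).
    by rewrite sumrB -!mulr_sumr sf card_ksetsE; ring.
  by apply: eq_bigr => A _; case: (f01 A) => ->; ring.
rewrite -moment3 // -sumrB -card_ksetsE -moment2 //.
apply: (@le_trans _ _ (sqnorm k h / (2 * tau) + 3 * tau / 2 *
    (\sum_(A in ksets n k) 1 + \sum_(A in ksets n k) G A ^+ 2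
     + \sum_(A in ksets n k) G A ^+ 4))); last first.
  by rewrite lerD2l ler_wpM2l ?lerD2l ?moment4_le // divr_ge0 // mulr_ge0 // ltW.
rewrite /sqnorm mulr_suml -!big_split /= mulr_sumr -big_split /=.
apply: ler_sum => A _.
pose F := f A - mu; pose g := G A; have hE : h A = F - g by rewrite /F /g fE; ring.
rewrite -/F -/g hE; have F1 : F ^+ 2 <= 1.
  rewrite -[1](expr1n _ 2) -subr_ge0 subr_sqr mulr_ge0 //; rewrite /F;
  by case: (f01 A) => ->; lra.
pose Y := F ^+ 2 + F * g + g ^+ 2.
have Y2 : Y ^+ 2 <= 3 * (1 + g ^+ 2 + g ^+ 4).
  have s1 := sqr_ge0 (F ^+ 2 - F * g).
  have s2 := sqr_ge0 (F ^+ 2 - g ^+ 2).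
  have s3 := sqr_ge0 (F * g - g ^+ 2).
  have t1 := mulr_ge0 (sqr_ge0 g) (_ : 0 <= 1 - F ^+ 2).
  have {}t1 := t1 ltac:(lra).
  have t2 := mulr_ge0 (sqr_ge0 F) (_ : 0 <= 1 - F ^+ 2).
  have {}t2 := t2 ltac:(lra).
  rewrite /Y; lra.
have -> : F ^+ 3 - g ^+ 3 = (F - g) * Y by rewrite /Y; ring.
have P : (F - g) * Y <= (F - g) ^+ 2 / (2 * tau) + tau / 2 * Y ^+ 2.
  rewrite -(ler_pM2r (_ : 0 < 2 * tau)); last by rewrite mulr_gt0.
  rewrite [X in _ <= X]mulrDl divfK; last by rewrite mulf_neq0 // gt_eqF.
  have := sqr_ge0 ((F - g) - tau * Y); lra.
apply: le_trans P _; rewrite lerD2l.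
have := ler_wpM2l (_ : 0 <= tau / 2) Y2.
move=> /(_ ltac:(lra)); lra.
Qed.

End Energy.
End Decomposition.

(** * Stability *)

(** The index of a largest coefficient; it becomes the centre of the star. *)
Lemma psum3_le_max (R : realFieldType) (n : nat) (a : 'I_n -> R) : (0 < n)%N ->
  exists i, psum a 3 <= a i * psum a 2.
Proof.
move=> n0; pose i0 := Ordinal n0.
pose i := [arg max_(i > i0 | true) a i]%O.
have im l : a l <= a i by rewrite /i; case: arg_maxP => // m _ /(_ l isT).
exists i; rewrite /psum mulr_sumr; apply: ler_sum => l _.
by rewrite exprS ler_wpM2r // sqr_ge0.
Qed.

(** [theta] depends on [beta] and [eps] only, and n enters through explicit lower bounds, so that
    the result applies to every container at once. *)
Theorem kneser_stability (R : realFieldType) (beta eps : R) :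
  0 < beta -> beta < 1 / 4 -> 0 < eps -> eps <= 1 ->
  exists2 theta : R, 0 < theta < 1 &
  forall (n k : nat) (S : {set {set 'I_n}}),
    8 <= eps * n%:R -> 3 <= beta * n%:R ->
    beta * n%:R < k%:R -> k%:R < (1 / 2 - beta) * n%:R ->
    S \subset ksets n k ->
    (1 - theta) * (k%:R / n%:R) * 'C(n, k)%:R <= #|S|%:R ->
    (forall A, A \in S ->
      #|[set B in S | B \subset ~: A]%SET|%:R <= theta * 'C(n - k, k)%:R) ->
    exists i, #|missing S i|%:R <= eps * (k%:R / n%:R) * 'C(n, k)%:R.
Proof.
move=> b0 b4 e0 e1.
pose tau : R := eps * beta ^+ 4 / (64 * 64).
pose theta : R := tau * beta ^+ 4 * eps / 32.
have tau0 : 0 < tau by rewrite divr_gt0 ?mulr_gt0 ?exprn_gt0.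
have th0 : 0 < theta by rewrite !mulr_gt0 ?invr_gt0 ?exprn_gt0.
exists theta.
  rewrite th0 /theta; have b1 : beta ^+ 4 <= 1 by apply: exprn_ile1; [exact: ltW|lra].
  have t1 : tau <= 1.
    rewrite /tau ler_pdivrMr // mul1r; apply: (@le_trans _ _ 1); last by clear; lra.
    by apply: mulr_ile1 => //; [exact: ltW | rewrite exprn_ge0 // ltW].
  have : tau * beta ^+ 4 * eps <= 1.
    have [t0 b40] : 0 <= tau /\ 0 <= beta ^+ 4 by split; rewrite ?exprn_ge0 // ltW.
    apply: mulr_ile1 => //; [exact: mulr_ge0|exact: ltW|exact: mulr_ile1].
  by rewrite ltr_pdivrMr //; lra.
move=> n k S en bn bk kb sS cS deg.
have n0 : 0 < n%:R :> R by clear -e0 en; rewrite -(pmulr_rgt0 _ e0); lra.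
have k3 : (2 < k)%N.
  by rewrite -(ltr_nat R); clear -bn bk; lra.
have k2n : (k.*2 < n)%N.
  rewrite -(ltr_nat R) -mul2n natrM; clear -kb b0 n0.
  by have := mulr_gt0 b0 n0; lra.
pose f (A : {set 'I_n}) : R := (A \in S)%:R.
have kn : (1 < k < n)%N by clear -k3 k2n; lia.
have [mu [a [h [dec degE]]]] := decomposition_exists f kn.
have k1 : (1 < k)%N by clear -k3 k2n; lia.
have N0 : 0 < 'C(n, k)%:R :> R by rewrite ltr0n bin_gt0; clear -k3 k2n; lia.
have D0 : 0 < 'C(n - k, k)%:R :> R by rewrite ltr0n bin_gt0; clear -k3 k2n; lia.
have Sf (F : {set 'I_n} -> R) : \sum_(A in ksets n k) f A * F A = \sum_(A in S) F A.
  rewrite big_mkcond [RHS]big_mkcond; apply: eq_bigr => A _; rewrite /f.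
  case: (boolP (A \in S)) => AS; last by rewrite mul0r; case: ifP.
  by rewrite (fintype.subsetP sS _ AS) mul1r.
have SM : #|S|%:R = 'C(n, k)%:R * mu.
  case: (dec) => _ _ <- _; under eq_bigr do rewrite -[f _]mulr1.
  by rewrite (Sf (fun=> 1)) sumr_const.
have E1 := sum_sqr_decomposed dec k1 k2n.
have E2 := sum_kneser_decomposed dec k1 k2n.
have E3 := sum_kneser_orth1_ge dec k1 k2n.
have mu01 : 0 <= mu <= 1.
  rewrite -(pmulr_rge0 _ N0) -SM ler0n /= -(ler_pM2l N0) -SM mulr1 ler_nat.
  by rewrite -[n in 'C(n, k)]card_ord -card_draws; apply: subset_leq_card.
have E4 := cubic_decomposed dec k1 k2n tau0 _ mu01.
have {}E4 := E4 ltac:(by move=> A; rewrite /f; case: (A \in S); [right|left]).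
have f2 : \sum_(A in ksets n k) f A ^+ 2 = 'C(n, k)%:R * mu.
  rewrite -SM; transitivity (\sum_(A in ksets n k) f A * 1).
    by apply: eq_bigr => A _; rewrite /f mulr1; case: (A \in S); rewrite ?expr0n ?expr1n.
  by rewrite (Sf (fun=> 1)) sumr_const.
(* The quadratic form counts ordered disjoint pairs in S: at most theta D for each of at most N
   members. *)
have E2' : \sum_(A in ksets n k) f A * kneser k f A <=
    theta * ('C(n, k)%:R * 'C(n - k, k)%:R).
  rewrite Sf; apply: (@le_trans _ _ (\sum_(A in S) theta * 'C(n - k, k)%:R)).
    apply: ler_sum => A AS; apply: le_trans (deg A AS).
    rewrite /kneser -sum1_card natr_sum big_mkcond [leRHS]big_mkcond /=.
    apply: ler_sum => B _; rewrite !inE /f.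
    case: (boolP (B \in S)) => BS /=; last by case: ifP.
    by move: (fintype.subsetP sS _ BS); rewrite inE => ->.
  rewrite sumr_const -[X in X <= _]mulr_natl SM mulrCA; apply: ler_wpM2l; first exact: ltW.
  rewrite mulrAC; apply: ler_piMr; last by case/andP: mu01.
  by rewrite mulr_ge0 // ltW.
have [i s3le] := psum3_le_max a (ltac:(clear -k3 k2n; lia) : (0 < n)%N).
exists i.
pose ka : R := k%:R / n%:R.
pose V : R := ka * (1 - ka) * (n%:R / (n%:R - 1)).
have n00 : n%:R != 0 :> R by rewrite gt_eqF.
have n10 : n%:R - 1 != 0 :> R by rewrite subr_eq0 (eqr_nat R n 1); clear -k3 k2n; lia.
have n20 : n%:R - 2 != 0 :> R by rewrite subr_eq0 (eqr_nat R n 2); clear -k3 k2n; lia.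
have nk0 : n%:R - k%:R != 0 :> R by rewrite subr_eq0 eqr_nat; clear -k3 k2n; lia.
have c12 : ncontain R n k 1 - ncontain R n k 2 = 'C(n, k)%:R * V.
  rewrite ncontain1 ?ncontain2; [|clear -k3 k2n; lia..]; rewrite /V /ka; field.
  by rewrite n00 n10.
have c123 : ncontain R n k 1 - 3 * ncontain R n k 2 + 2 * ncontain R n k 3 =
    'C(n, k)%:R * (V * (1 - 2 * ka) * (n%:R / (n%:R - 2))).
  rewrite ncontain1 ?ncontain2 ?ncontain3; [|clear -k3 k2n; lia..]; rewrite /V /ka; field.
  by rewrite n00 n10 n20.
have rE : k%:R / (n%:R - k%:R) = ka / (1 - ka).
  by rewrite /ka; field; rewrite n00 nk0.
pose w := sqnorm k h / 'C(n, k)%:R.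
have wE : sqnorm k h = 'C(n, k)%:R * w by rewrite /w mulrC divfK // gt_eqF.
(* Size of S minus the degree of i, which the decomposition expresses through [a i]. *)
have -> : #|missing S i|%:R = 'C(n, k)%:R * (mu - ka * mu - V * a i).
  have -> : 'C(n, k)%:R * (mu - ka * mu - V * a i) =
    'C(n, k)%:R * mu - (k%:R / n%:R * ('C(n, k)%:R * mu) + 'C(n, k)%:R * V * a i).
    by rewrite /ka; ring.
  rewrite -c12 -degE Sf -SM -!sum1_card !natr_sum -sumrB /missing.
  rewrite big_mkcond [RHS]big_mkcond /=; apply: eq_bigr => A _; rewrite !inE.
  by case: (A \in S) => //=; case: (i \in A) => //=; rewrite ?subrr ?subr0.
rewrite mulrC ler_pM2r //.
have [mu0 mu1] := andP mu01.
rewrite f2 c12 wE in E1; rewrite E2 c12 rE in E2'; rewrite wE rE in E3.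
rewrite c12 c123 wE ncontain1 in E4; last by clear -k3 k2n; lia.
have kaE : ka * n%:R = k%:R by rewrite /ka divfK.
apply: (@dictator_numerics _ beta eps n%:R ka mu w (psum a 2) (psum a 3) (a i) theta tau) => //.
- by rewrite (ltr_nat R 2 n); clear -k3 k2n; lia.
- by rewrite -(ler_pM2r n0) kaE ltW.
- by rewrite -(ler_pM2r n0) kaE ltW.
- by rewrite -(ler_pM2l N0) -SM mulrC.
- by rewrite /w divr_ge0 ?sqnorm_ge0 // ltW.
- by apply: sumr_ge0 => l _; rewrite sqr_ge0.
- apply: (mulfI (lt0r_neq0 N0)); rewrite -/V E1; ring.
- have ND : 0 < 'C(n, k)%:R * 'C(n - k, k)%:R :> R by rewrite mulr_gt0.
  rewrite -(ler_pM2l ND) -/V; set r := ka / _ in E2' E3 *.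
  clear -E2' E3; lra.
- by rewrite -(ler_pM2l N0) -/V; apply: etrans E4; congr (_ <= _); rewrite -/ka; ring.
Qed.

(** * Containers and exponential tails *)

(* The fingerprint T records which of the successively chosen vertices of large
   degree belong to I, and S T is what remains when none is left. *)
Lemma graph_containers (R : realFieldType) (V : finType) (e : rel V) (g : R)
    (X : {set V}) : 0 <= g ->
  exists S : {set V} -> {set V},
    (forall T, S T \subset X /\
      forall v, v \in S T -> #|[set y in S T | e v y]%SET|%:R <= g) /\
    (forall I : {set V}, I \subset X -> {in I &, forall x y, ~~ e x y} ->
      exists T : {set V}, [/\ T \subset I, #|T|%:R * g <= #|X|%:R & I \subset T :|: S T]).
Proof.
move=> g0; have [m] := ubnP #|X|; elim: m X => // m IH X Xm.
have [/existsP[v /andP[vX vg]]|noX] :=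
    boolP [exists v in X, g < #|[set y in X | e v y]%SET|%:R]; last first.
  exists (fun=> X); split=> [T|I IX _].
    split=> // v vX; rewrite leNgt; apply: contra noX => vg.
    by apply/existsP; exists v; rewrite vX.
  by exists finset.set0; rewrite finset.sub0set cards0 mul0r set0U.
pose Nv := [set y in X | e v y]%SET.
have lt1 : (#|X :\ v| < #|X|)%N by rewrite (cardsD1 v X) vX.
have lt2 : (#|X :\ v :\: Nv| < m)%N.
  by apply: leq_ltn_trans (subset_leq_card (subsetDl _ _)) _; apply: leq_trans lt1 _.
have [S1 [S1P S1I]] := IH _ lt2.
have [S2 [S2P S2I]] := IH (X :\ v) (leq_trans lt1 Xm).
(* A fingerprint with v in it discards v and its neighbours; one without v discards v alone. *)
exists (fun T : {set V} => if v \in T then S1 (T :\ v) else S2 T); split=> [T|I IX ind].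
  case: ifP => _; [have [s d] := S1P (T :\ v) | have [s d] := S2P T]; split=> //.
    by apply: subset_trans s _; apply: subset_trans (subsetDl _ _) (subD1set _ _).
  by apply: subset_trans s (subD1set _ _).
have [vI|vI] := boolP (v \in I); last first.
  have [||T [TI Tg IT]] := S2I I => //; first by rewrite subsetD1 IX.
  exists T; split=> //; first by apply: le_trans Tg _; rewrite ler_nat ltnW.
  by rewrite ifN //; apply: contra vI; apply: fintype.subsetP TI v.
have [||T [TI Tg IT]] := S1I (I :\ v).
- apply/fintype.subsetP => x; rewrite !inE => /andP[xv xI].
  by rewrite xv (fintype.subsetP IX) //= andbT; apply: ind.
- by move=> x y /setD1P[_ xI] /setD1P[_ yI]; apply: ind.
have vT : v \notin T by apply/negP => /(fintype.subsetP TI); rewrite !inE eqxx.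
exists (v |: T); split.
- rewrite subUset sub1set vI; apply: subset_trans TI (subD1set _ _).
- rewrite cardsU1 vT natrD mulrDl mul1r.
  (* Discarding more than g neighbours pays for the new element of the fingerprint. *)
  have : #|X :\ v :\: Nv|%:R + #|Nv|%:R <= #|X|%:R :> R.
    rewrite -natrD ler_nat -(cardsID Nv X) addnC leq_add ?subset_leq_card //.
      by apply/fintype.subsetP => x; rewrite !inE => /andP[-> ->].
    by apply: setSD; apply: subD1set.
  by rewrite -/Nv in vg; lra.
- rewrite setU11 setU1K //; apply/fintype.subsetP => x xI.
  case: (eqVneq x v) => [->|xv]; first by rewrite !inE eqxx.
  have := fintype.subsetP IT x; rewrite !inE xv xI => /(_ isT) /orP[] ->; by rewrite ?orbT.
Qed.

(** Outside K the two factors are set to 0 and 1, so the expansion over all H keeps only the subsets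
    of K. *)
Lemma sum_subset_prod (R : comPzRingType) (V : finType) (K : {set V}) (P Q : V -> R) :
  \sum_(H : {set V} | H \subset K) \prod_(e in K) (if e \in H then P e else Q e) =
  \prod_(e in K) (P e + Q e).
Proof.
pose F e := if e \in K then P e else 0.
pose G e := if e \in K then Q e else 1.
have -> : \prod_(e in K) (P e + Q e) = \prod_e (F e + G e).
  rewrite big_mkcond; apply: eq_bigr => e _; rewrite /F /G.
  by case: ifP => _; rewrite ?add0r.
rewrite bigA_distr big_mkcond; apply: eq_bigr => H _.
case: ifPn => [sH|/subsetPn[e eH eN]]; last first.
  by rewrite (bigD1 e) //= eH /F (negbTE eN) mul0r.
rewrite big_mkcond; apply: eq_bigr => e _; rewrite /F /G.
case: (boolP (e \in K)) => // eN.
by case: ifP => // /(fintype.subsetP sH); rewrite (negbTE eN).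
Qed.

Lemma prodr_ifsetE (R : comPzRingType) (V : finType) (K Z : {set V}) (b : R) :
  Z \subset K -> \prod_(e in K) (if e \in Z then b else 1) = b ^+ #|Z|.
Proof.
move=> ZK; rewrite -prodr_const big_mkcond [RHS]big_mkcond; apply: eq_bigr => e _.
by case: (boolP (e \in Z)) => [/(fintype.subsetP ZK) -> // | _]; case: ifP.
Qed.

(** From 1 - x <= exp(-x) and 1 <= (1 - x)(1 + x + 2 x^2) for x <= 1/2. *)
Lemma expR_le_quad (R : realType) (x : R) : 0 <= x -> x <= 1 / 2 ->
  expR x - 1 <= x + 2 * x ^+ 2.
Proof.
move=> x0 x1; have := @expR_ge1Dx R (- x).
rewrite expRN => H; have e0 := expR_gt0 x.
have : (1 - x) * expR x <= 1.
  by have := ler_wpM2r (ltW e0) H; rewrite mulVf ?gt_eqF.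
move=> H2.
have H3 : 1 <= (1 - x) * (1 + x + 2 * x ^+ 2).
  have := mulr_subs_ge0 (sqr_ge0 x) x1; lra.
have : (1 - x) * expR x <= (1 - x) * (1 + x + 2 * x ^+ 2) by apply: le_trans H2 H3.
by rewrite ler_pM2l; lra.
Qed.

(** Markov's inequality for exp(la |H :&: Z|) restricted to H containing T. By independence each
    edge of T contributes p and each edge of Z contributes 1 + p (exp(la) - 1); as T and Z are
    disjoint, no edge has both roles. *)
Lemma hyp_tail (R : realType) (n k : nat) (p la L : R) (T Z : {set {set 'I_n}})
    (E : pred {set {set 'I_n}}) :
  0 <= p -> p <= 1 -> 0 <= la -> T \subset ksets n k -> Z \subset ksets n k ->
  [disjoint T & Z] ->
  (forall H : {set {set 'I_n}}, E H -> T \subset H /\ L <= #|H :&: Z|%:R) ->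
  hyp_prob k p E <= p ^+ #|T| * expR (p * (expR la - 1) * #|Z|%:R - la * L).
Proof.
move=> p0 p1 la0 TK ZK TZ EP; set K := ksets n k.
pose b := expR la.
have b1 : 1 <= b by rewrite /b -expR0 ler_expR.
pose P (e : {set 'I_n}) := p * (if e \in Z then b else 1).
(* Weight 0 for an absent edge of T confines the sum to the H that contain T. *)
pose Q (e : {set 'I_n}) := if e \in T then 0 else 1 - p.
have q0 : 0 <= 1 - p by rewrite subr_ge0.
have P0 e : 0 <= P e by rewrite mulr_ge0 //; case: ifP => // _; apply: le_trans b1.
have Q0 e : 0 <= Q e by rewrite /Q; case: ifP.
have step1 : hyp_prob k p E * expR (la * L) <= \prod_(e in K) (P e + Q e).
  rewrite -sum_subset_prod /hyp_prob mulr_suml big_mkcond /= [leRHS]big_mkcond /=.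
  apply: ler_sum => H _; rewrite -/K; case: (boolP (H \subset K)) => //= HK.
  case: ifPn => EH; last first.
    by apply: prodr_ge0 => e _; case: ifP.
  have [TH LH] := EP H EH.
  have -> : \prod_(e in K) (if e \in H then P e else Q e) =
      hyp_weight k p H * \prod_(e in K) (if e \in H :&: Z then b else 1).
    rewrite /hyp_weight -big_split /=; apply: eq_bigr => e eK; rewrite inE /P /Q.
    case: (boolP (e \in H)) => eH //=; rewrite mulr1.
    by rewrite ifN //; apply: contra eH; apply: fintype.subsetP TH e.
  rewrite prodr_ifsetE; last by apply: subset_trans (subsetIr _ _) ZK.
  apply: ler_wpM2l; first by apply: prodr_ge0 => e _; case: ifP.
  by rewrite /b -expRM_natl ler_expR mulrC ler_wpM2r.
have step2 : \prod_(e in K) (P e + Q e) = p ^+ #|T| * (1 + p * (b - 1)) ^+ #|Z|.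
  rewrite -(prodr_ifsetE _ TK) -(prodr_ifsetE _ ZK) -big_split /=.
  apply: eq_bigr => e eK; rewrite /P /Q.
  have := disjointFr TZ; case: (boolP (e \in T)) => eT.
    by move=> /(_ e eT) ->; rewrite addr0 !mulr1.
  by move=> _; case: ifP => _; rewrite ?mul1r; ring.
rewrite expRD expRN mulrA ler_pdivlMr ?expR_gt0 //; apply: le_trans step1 _.
rewrite step2; apply: ler_wpM2l; first exact: exprn_ge0.
rewrite [_ * #|Z|%:R]mulrC expRM_natl; apply: lerXn2r; rewrite ?nnegrE ?expR_ge0 //.
  by rewrite addr_ge0 // mulr_ge0 // subr_ge0.
exact: expR_ge1Dx.
Qed.

(** One Vandermonde term gives k C(n-k, k-1) <= C(n, k), hence k^2 D <= n N. This makes p N grow at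
    least linearly in n once p >= C / D. *)
Lemma bin_ratio_ge (R : realFieldType) (n k : nat) (beta : R) :
  0 <= beta -> (0 < k)%N -> (k.*2 < n)%N -> beta * n%:R <= k%:R ->
  beta ^+ 2 * n%:R * 'C(n - k, k)%:R <= 'C(n, k)%:R.
Proof.
move=> b0 k0 kn bk.
have n0 : 0 < n%:R :> R by rewrite ltr0n; lia.
have H : (k * k * 'C(n - k, k) <= n * 'C(n, k))%N.
  have V : (k * 'C(n - k, k.-1) <= 'C(n, k))%N.
    have -> : 'C(n, k) = 'C(k + (n - k), k) by congr 'C(_, _); lia.
    rewrite -binomial.Vandermonde.
    have lt1 : (1 < k.+1)%N by lia.
    by rewrite (bigD1 (Ordinal lt1)) //= bin1 subn1 leq_addr.
  have E : (k * 'C(n - k, k) = (n - k - k.-1) * 'C(n - k, k.-1))%N.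
    by have := mul_bin_left (n - k) k.-1; rewrite prednK.
  have : (n - k - k.-1 <= n)%N by lia.
  by nia.
rewrite -(ler_pM2l n0); apply: le_trans (_ : (k * k * 'C(n - k, k))%:R <= _); last first.
  by rewrite -natrM ler_nat.
rewrite !natrM mulrA ler_wpM2r //.
have -> : n%:R * (beta ^+ 2 * n%:R) = (beta * n%:R) * (beta * n%:R) by ring.
by apply: ler_pM => //; rewrite mulr_ge0.
Qed.

(** * The union bound *)

(** The tilt zeta / 4 gains zeta^2 / 4 times the mean size p ka N, and the quadratic term of the
    exponential costs at most half of that. *)
Lemma chernoff_exponent_le (R : realType) (beta ka N p z zeta Z : R) :
  0 <= p -> 0 <= N -> beta <= ka -> 0 <= ka -> 0 <= zeta -> zeta <= 1 ->
  0 <= z -> z <= 1 -> Z <= z * ka * N ->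
  p * (expR (zeta / 4) - 1) * Z - zeta / 4 * ((z + zeta) * (p * ka * N)) <=
  - (beta * zeta ^+ 2 / 8 * p * N).
Proof.
move=> p0 N0 bk k0 ze0 ze1 z0 z1 ZN.
set u := expR (zeta / 4) - 1.
have u0 : 0 <= u by rewrite /u subr_ge0 -expR0 ler_expR divr_ge0.
have ule : u <= zeta / 4 + zeta ^+ 2 / 8.
  have h1 : 0 <= zeta / 4 by lra.
  have h2 : zeta / 4 <= 1 / 2 by lra.
  by have := expR_le_quad h1 h2; rewrite -/u; lra.
pose m := p * ka * N.
have m0 : 0 <= m by rewrite !mulr_ge0.
have s1 : p * u * Z <= u * z * m.
  have -> : u * z * m = p * u * (z * ka * N) by rewrite /m; ring.
  by apply: ler_wpM2l => //; apply: mulr_ge0.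
have s2 : u * z * m <= (zeta / 4 + zeta ^+ 2 / 8) * z * m.
  by apply: ler_wpM2r => //; apply: ler_wpM2r.
have s3 : zeta ^+ 2 / 8 * m * z <= zeta ^+ 2 / 8 * m * 1.
  by apply: ler_wpM2l => //; rewrite mulr_ge0 // divr_ge0 // sqr_ge0.
have s4 : zeta ^+ 2 / 8 * (p * N) * beta <= zeta ^+ 2 / 8 * (p * N) * ka.
  by apply: ler_wpM2l => //; rewrite mulr_ge0 // ?divr_ge0 ?sqr_ge0 // mulr_ge0.
rewrite -/m; have mE : m = p * N * ka by rewrite /m; ring.
by rewrite mE in s1 s2 s3 *; lra.
Qed.

(* Each term is multiplied by exp (y * (t - |T|)) >= 1; the sum over all subsets
   then factorizes. *)
Lemma sum_small_subsets (R : realType) (V : finType) (K : {set V}) (p t y : R) :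
  0 <= p -> 0 <= y ->
  \sum_(T : {set V} | (T \subset K) && (#|T|%:R <= t)) p ^+ #|T| <=
  expR (p * expR (- y) * #|K|%:R + y * t).
Proof.
move=> p0 y0; set x := expR (- y).
have x0 : 0 <= x := expR_ge0 _.
apply: (@le_trans _ _ (\sum_(T : {set V} | T \subset K) (p * x) ^+ #|T| * expR (y * t))).
  rewrite big_mkcond [leRHS]big_mkcond /=; apply: ler_sum => T _.
  case: (boolP (T \subset K)) => //= _; case: ifP => [Tt|_]; last first.
    by rewrite mulr_ge0 ?expR_ge0 // exprn_ge0 // mulr_ge0.
  rewrite exprMn -mulrA ler_peMr ?exprn_ge0 // /x -expRM_natl -expRD -[X in X <= _]expR0 ler_expR.
  by have := mulr_subs_ge0 y0 Tt; lra.
rewrite -mulr_suml expRD ler_wpM2r ?expR_ge0 //.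
have -> : \sum_(T : {set V} | T \subset K) (p * x) ^+ #|T| =
    \prod_(e in K) (p * x + 1).
  rewrite -sum_subset_prod; apply: eq_bigr => T TK.
  by rewrite prodr_ifsetE.
rewrite prodr_const [_ * #|K|%:R]mulrC expRM_natl.
apply: lerXn2r; rewrite ?nnegrE ?expR_ge0 ?addr_ge0 ?mulr_ge0 //.
by rewrite addrC expR_ge1Dx.
Qed.

Lemma hyp_prob_compl (R : realType) (n k : nat) (p : R) (E : pred {set {set 'I_n}}) :
  hyp_prob k p E = 1 - hyp_prob k p (predC E).
Proof.
rewrite -(@hyp_prob_total R n k p) /hyp_prob.
under [X in _ = X - _]eq_bigl do rewrite andbT.
by rewrite [X in _ = X - _](bigID E) /= addrK.
Qed.

Lemma hyp_prob_ge0 (R : realType) (n k : nat) (p : R) (E : pred {set {set 'I_n}}) :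
  0 <= p -> p <= 1 -> 0 <= hyp_prob k p E.
Proof.
move=> p0 p1; apply: sumr_ge0 => H _; apply: prodr_ge0 => e _.
by case: ifP => // _; rewrite subr_ge0.
Qed.

Section UnionBound.
Variables (R : realType) (n k : nat) (p beta eps theta zeta c : R).
Local Notation K := (ksets n k).
Local Notation N := ('C(n, k)%:R : R).
Local Notation D := ('C(n - k, k)%:R : R).
Local Notation ka := (k%:R / n%:R : R).
Hypotheses (p0 : 0 < p) (p1 : p <= 1) (beta0 : 0 < beta) (beta1 : beta <= 1).
Hypotheses (eps0 : 0 < eps) (eps1 : eps <= 1) (th0 : 0 < theta) (th1 : theta < 1).
Hypotheses (ze0 : 0 < zeta) (zeth : zeta <= theta / 4) (zeeps : zeta <= eps / 4).
Hypothesis cE : c = beta * zeta ^+ 2 / 8.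
Hypotheses (bka : beta <= ka) (N0 : 0 < N) (D0 : 0 < D).
Hypothesis pC : 16 / (theta * c ^+ 2) / D <= p.
Hypothesis stab : forall S : {set {set 'I_n}}, S \subset K ->
  (1 - theta) * ka * N <= #|S|%:R ->
  (forall A, A \in S -> #|[set B in S | B \subset ~: A]%SET|%:R <= theta * D) ->
  exists i, #|missing S i|%:R <= eps / 2 * ka * N.

(** F refutes the conclusion for H with delta = theta / 2; the other half of theta is left for the
    fingerprint and the random fluctuation. *)
Definition bad_witness (H F : {set {set 'I_n}}) : bool :=
  [&& F \subset H, intersecting F,
      (1 - theta / 2) * p * ka * N <= #|F|%:R &
      ~~ [exists i, #|missing F i|%:R <= eps * p * ka * N]].

Let c0 : 0 < c.
Proof. by rewrite cE divr_gt0 // mulr_gt0 // exprn_gt0. Qed.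

Let cle : c <= beta * zeta.
Proof.
have ze1 : zeta <= 1 by move: zeeps eps1; lra.
rewrite cE expr2; have := mulr_ge0 (ltW beta0) (ltW ze0).
have := mulr_subs_ge0 (mulr_ge0 (ltW beta0) (ltW ze0)) ze1; lra.
Qed.

(** The constant in [pC] is chosen for this: the maximal fingerprint size, multiplied by the 4 / c
    of the union bound, is at most a quarter of the Chernoff exponent c p N. *)
Let tle : N / (theta * D) <= c ^+ 2 / 16 * (p * N).
Proof.
have tD0 : 0 < theta * D by rewrite mulr_gt0.
rewrite ler_pdivrMr //.
have h : 1 <= c ^+ 2 / 16 * p * (theta * D).
  by move: pC; rewrite ler_pdivrMr // ler_pdivrMr ?mulr_gt0 ?exprn_gt0 //; lra.
by have := ler_wpM2l (ltW N0) h; lra.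
Qed.

(** Follows from c^2 / 16 <= c <= beta zeta <= zeta ka. *)
Lemma card_fingerprint_le (T : {set {set 'I_n}}) :
  #|T|%:R * (theta * D) <= N -> #|T|%:R <= zeta * (p * ka * N).
Proof.
move=> Tg; have tD0 : 0 < theta * D by rewrite mulr_gt0.
apply: (@le_trans _ _ (N / (theta * D))); first by rewrite ler_pdivlMr.
apply: le_trans tle _.
have pN : 0 <= p * N by rewrite mulr_ge0 // ltW.
have -> : zeta * (p * ka * N) = zeta * ka * (p * N) by ring.
apply: ler_wpM2r => //.
have h1 : c ^+ 2 / 16 <= c.
  have cl1 : c <= 1.
    apply: le_trans cle _; have ze1 : zeta <= 1 by move: zeeps eps1; lra.
    by apply: mulr_ile1 => //; exact: ltW.
  have := mulr_subs_ge0 (ltW c0) cl1; have := sqr_ge0 c; have := ltW c0; lra.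
apply: le_trans h1 (le_trans cle _); rewrite mulrC; apply: ler_wpM2l => //.
exact: ltW.
Qed.

(** In both cases H must contain T and also exceed by zeta m the bound z m on the mean number of its
    edges in a set Z disjoint from T: either Z is all of S :\: T, or Z is what S :\: T has outside a
    star. *)
Lemma hyp_prob_container_le (T S : {set {set 'I_n}}) :
  T \subset K -> S \subset K ->
  (forall A, A \in S -> #|[set B in S | B \subset ~: A]%SET|%:R <= theta * D) ->
  #|T|%:R * (theta * D) <= N ->
  hyp_prob k p (fun H => [exists F, [&& bad_witness H F, T \subset F & F \subset T :|: S]])
    <= p ^+ #|T| * expR (- (c * p * N)).
Proof.
move=> TK SK deg Tg; have Tle := card_fingerprint_le Tg.
have ka0 : 0 < ka by apply: lt_le_trans bka.
pose m := p * ka * N; have m0 : 0 < m by apply: mulr_gt0 => //; apply: mulr_gt0.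
have ze1 : zeta <= 1 by move: zeeps eps1; lra.
suff [Z [z [ZK TZ /andP[z0 z1] Zle HZ]]] : exists (Z : {set {set 'I_n}}) z,
  [/\ Z \subset K, [disjoint T & Z], 0 <= z <= 1, #|Z|%:R <= z * ka * N &
    forall H F, bad_witness H F -> T \subset F -> F \subset T :|: S ->
      (z + zeta) * m <= #|H :&: Z|%:R].
  apply: le_trans (hyp_tail (la := zeta / 4) (L := (z + zeta) * m) _ _ _ TK ZK TZ _) _ => //.
  - exact: ltW.
  - by rewrite divr_ge0 // ltW.
  - move=> H /existsP[F /and3P[bF TF FS]]; split; last exact: HZ bF TF FS.
    by apply: subset_trans TF _; case/and4P: bF.
  apply: ler_wpM2l; first by rewrite exprn_ge0 // ltW.
  rewrite ler_expR cE /m; apply: chernoff_exponent_le => //; exact: ltW.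
pose S' := S :\: T.
have S'K : S' \subset K by apply: subset_trans (subsetDl _ _) SK.
have TS' : [disjoint T & S'] by rewrite disjoint_sym disjoints_subset subsetDr.
have [Slt|Sge] := ltP (#|S'|%:R : R) ((1 - theta) * ka * N).
  (* F has at least (1 - theta / 2) m members and T at most zeta m; zeta <= theta / 4 leaves (1 -
     theta + zeta) m in Z. *)
  exists S', (1 - theta); split => //; [by move: th0 th1; lra|exact: ltW|].
  move=> H F /and4P[FH _ Fle _] TF FS.
  have : (#|F| <= #|T| + #|H :&: S'|)%N.
    rewrite -(cardsID T F) leq_add ?subset_leq_card ?subsetIr //.
    apply/fintype.subsetP => A; rewrite !inE => /andP[AT AF].
    by rewrite (fintype.subsetP FH) //= AT; move: (fintype.subsetP FS _ AF); rewrite !inE (negbTE AT).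
  rewrite -(ler_nat R) natrD => FT.
  have E : (1 - theta / 2) * p * ka * N = (1 - theta / 2) * m by rewrite /m; ring.
  rewrite {}E in Fle; rewrite -/m in Tle.
  have := mulr_subs_ge0 zeth (ltW m0); lra.
have [|i iS] := stab S'K Sge.
  move=> A AS'; apply: le_trans (deg A _); last by move: AS'; rewrite inE => /andP[].
  rewrite ler_nat subset_leq_card //; apply/fintype.subsetP => B; rewrite !inE.
  by move=> /andP[/andP[_ ->] ->].
have mS : missing S' i \subset S' by apply/fintype.subsetP => A; rewrite !inE => /andP[].
(* More than eps m members of F miss i; without T at least (eps / 2 + zeta) m remain since zeta <=
   eps / 4. *)
exists (missing S' i), (eps / 2); split => //.
- exact: subset_trans mS S'K.
- by apply: disjointWr mS TS'.
- by apply/andP; move: eps0 eps1; split; lra.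
move=> H F /and4P[FH _ _ /existsPn/(_ i)] + TF FS; rewrite -ltNge => Fi.
have : (#|missing F i| <= #|T| + #|H :&: missing S' i|)%N.
  rewrite -(cardsID T (missing F i)) leq_add ?subset_leq_card ?subsetIr //.
  apply/fintype.subsetP => A; rewrite !inE => /and3P[AT AF iA].
  by rewrite (fintype.subsetP FH) //= AT iA; move: (fintype.subsetP FS _ AF); rewrite !inE (negbTE AT) /= => ->.
rewrite -(ler_nat R) natrD => FT.
have E : eps * p * ka * N = eps * m by rewrite /m; ring.
rewrite {}E in Fi; rewrite -/m in Tle.
have := mulr_subs_ge0 zeeps (ltW m0); lra.
Qed.

Lemma hyp_prob_bad_le :
  hyp_prob k p (fun H => [exists F, bad_witness H F]) <= expR (- (c / 2 * p * N)).
Proof.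
have g0 : 0 <= theta * D by rewrite mulr_ge0 // ltW.
have tD0 : 0 < theta * D by rewrite mulr_gt0.
have cK : #|K| = 'C(n, k).
  by rewrite -[in RHS](card_ord n) -card_draws; apply: eq_card => A; rewrite !inE.
have [S [SP SI]] := graph_containers (fun A B : {set 'I_n} => B \subset ~: A) K g0.
pose small (T : {set {set 'I_n}}) := (T \subset K) && (#|T|%:R <= N / (theta * D)).
pose badT (T H : {set {set 'I_n}}) :=
  [exists F, [&& bad_witness H F, T \subset F & F \subset T :|: S T]].
apply: (@le_trans _ _ (\sum_(T | small T) hyp_prob k p (badT T))).
  rewrite /hyp_prob (exchange_big_dep (fun H : {set {set 'I_n}} => H \subset K)) /=; last first.
    by move=> T H _ /andP[].
  rewrite big_mkcond [leRHS]big_mkcond; apply: ler_sum => H _.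
  case: (boolP (H \subset K)) => //= HK.
  have w0 : 0 <= hyp_weight k p H.
    by apply: prodr_ge0 => e _; case: ifP => // _; rewrite ?subr_ge0 // ltW.
  case: ifPn => [/existsP[F bF]|_]; last by apply: sumr_ge0.
  have [FH intF _ _] := and4P bF.
  (* An intersecting family is independent for the disjointness relation, hence has a
     fingerprint. *)
  have [||T [TF Tg FT]] := SI F; first exact: subset_trans FH HK.
    move=> A B AF BF; apply/negP => BA.
    have := forallP intF A; rewrite AF /= => /forallP/(_ B); rewrite BF /=.
    by rewrite setI_eq0 disjoint_sym disjoints_subset BA.
  have sT : small T.
    rewrite /small (subset_trans (subset_trans TF FH) HK) /=.
    by rewrite ler_pdivlMr // -cK.
  have bT : badT T H by apply/existsP; exists F; rewrite bF TF FT.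
  rewrite (bigD1 T) /=; last by rewrite sT bT.
  by rewrite lerDl; apply: sumr_ge0.
apply: (@le_trans _ _ (\sum_(T | small T) p ^+ #|T| * expR (- (c * p * N)))).
  apply: ler_sum => T /andP[TK Tt]; have [sT dT] := SP T.
  by apply: hyp_prob_container_le => //; rewrite -ler_pdivlMr.
rewrite -mulr_suml.
(* With y = 4 / c both terms of the entropy exponent are at most (c / 4) p N, as exp(-4 / c) <= c /
   4; half of c p N survives. *)
have y0 : 0 <= 4 / c by rewrite divr_ge0 // ltW.
apply: le_trans (ler_wpM2r (expR_ge0 _) (sum_small_subsets _ _ (ltW p0) y0)) _.
rewrite -expRD ler_expR cK.
have pN : 0 <= p * N by rewrite mulr_ge0 // ltW.
have b1 : p * expR (- (4 / c)) * N <= c / 4 * (p * N).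
  have -> : p * expR (- (4 / c)) * N = expR (- (4 / c)) * (p * N) by ring.
  apply: ler_wpM2r => //; rewrite expRN -[c / 4]invrK lef_pV2 ?posrE ?expR_gt0 //.
    rewrite invf_div; apply: le_trans (expR_ge1Dx _); lra.
  by rewrite invr_gt0 divr_gt0.
have b2 : 4 / c * (N / (theta * D)) <= c / 4 * (p * N).
  apply: le_trans (ler_wpM2l y0 tle) _.
  have -> : 4 / c * (c ^+ 2 / 16 * (p * N)) = c / 4 * (p * N); last by [].
  by field; rewrite gt_eqF.
by lra.
Qed.

End UnionBound.

(** * Choice of constants and passage to the limit *)

Lemma hyp_prob_le (R : realType) (n k : nat) (p : R) (E E' : pred {set {set 'I_n}}) :
  0 <= p -> p <= 1 -> (forall H, E H -> E' H) -> hyp_prob k p E <= hyp_prob k p E'.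
Proof.
move=> p0 p1 EE'; rewrite /hyp_prob big_mkcond [leRHS]big_mkcond /=.
apply: ler_sum => H _; case: (H \subset _) => //=.
have w0 : 0 <= hyp_weight k p H.
  by apply: prodr_ge0 => e _; case: ifP => // _; rewrite subr_ge0.
by case: (boolP (E H)) => [/EE' -> //|_]; case: ifP.
Qed.

Local Open Scope classical_set_scope.

Theorem theorem1p3 (R : realType) (beta eps : R) (hbeta : 0 < beta)
    (heps : 0 < eps) :
  exists delta C : R, [/\ 0 < delta, 0 < C &
    forall (k : nat -> nat) (p : nat -> R),
      (\forall n \near \oo,
         beta * n%:R < (k n)%:R /\ (k n)%:R < (1 / 2 - beta) * n%:R) ->
      (\forall n \near \oo,
         C * ('C(n - k n, k n)%:R)^-1 <= p n /\ p n <= 1) ->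
      (fun n : nat =>
         hyp_prob (k n) (p n) (fun H : {set {set 'I_n}} =>
           [forall F : {set {set 'I_n}},
              [&& F \subset H, intersecting F &
                  (1 - delta) * p n * ((k n)%:R / n%:R) * 'C(n, k n)%:R
                    <= #|F|%:R]
              ==> [exists i : 'I_n,
                    #|missing F i|%:R
                      <= eps * p n * ((k n)%:R / n%:R) * 'C(n, k n)%:R]]))
        @ \oo --> (1 : R)].
Proof.
(* Stability is available for small parameters; shrinking [beta] only widens the range of k, and
   shrinking [eps] strengthens the conclusion. *)
pose b : R := Num.min beta (1 / 8); pose e1 : R := Num.min eps 1.
have b0 : 0 < b by rewrite lt_min hbeta; lra.
have b8 : b <= 1 / 8 by rewrite ge_min lexx orbT.
have bb : b <= beta by rewrite ge_min lexx.
have e10 : 0 < e1 by rewrite lt_min heps; lra.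
have e11 : e1 <= 1 by rewrite ge_min lexx orbT.
have e1e : e1 <= eps by rewrite ge_min lexx.
(* Half of [e1] goes to the defect of the star; the other half absorbs the fingerprint and the
   fluctuation. *)
have [theta /andP[th0 th1] stab] : exists2 theta : R, 0 < theta < 1 & _ :=
  @kneser_stability R b (e1 / 2) b0 ltac:(lra) ltac:(lra) ltac:(lra).
pose zeta : R := Num.min (theta / 4) (e1 / 4).
have ze0 : 0 < zeta by rewrite lt_min; apply/andP; split; lra.
have zeth : zeta <= theta / 4 by rewrite ge_min lexx.
have zee : zeta <= e1 / 4 by rewrite ge_min lexx orbT.
clearbody b e1 zeta.
pose c : R := b * zeta ^+ 2 / 8.
have c0 : 0 < c by rewrite divr_gt0 // mulr_gt0 // exprn_gt0.
pose C : R := 16 / (theta * c ^+ 2).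
have C0 : 0 < C by rewrite divr_gt0 // mulr_gt0 // exprn_gt0.
exists (theta / 2), C; split => //; first by lra.
move=> k p krange prange; apply/cvgrPdist_le => e e0 /=.
(* Exponential rate: (c / 2) p N >= s n, by p >= C / D and N >= b^2 n D. *)
pose s : R := c / 2 * (C * b ^+ 2).
have s0 : 0 < s by apply: mulr_gt0; [apply: divr_gt0 | apply: mulr_gt0; rewrite ?exprn_gt0].
(* The first two thresholds on n are those of stability with [e1 / 2] and [b]; the third makes s n
   at least the inverse of [e]. *)
suff main (n m : nat) (q : R) :
    beta * n%:R < m%:R /\ m%:R < (1 / 2 - beta) * n%:R ->
    C * ('C(n - m, m)%:R)^-1 <= q /\ q <= 1 ->
    16 / e1 <= n%:R -> 3 / b <= n%:R -> e^-1 / s <= n%:R ->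
    `|1 - hyp_prob m q (fun H : {set {set 'I_n}} =>
         [forall F : {set {set 'I_n}},
            [&& F \subset H, intersecting F &
                (1 - theta / 2) * q * (m%:R / n%:R) * 'C(n, m)%:R <= #|F|%:R]
            ==> [exists i : 'I_n,
                  #|missing F i|%:R <= eps * q * (m%:R / n%:R) * 'C(n, m)%:R]])|
      <= e.
  near=> n; apply: main; near: n => //; exact: nbhs_infty_ger.
move: m q => {krange prange p}k p [kl ku] [pl pu] n1 n2 n3.
have {}n1 : 8 <= e1 / 2 * n%:R by move: n1; rewrite ler_pdivrMr //; lra.
have {}n2 : 3 <= b * n%:R by move: n2; rewrite ler_pdivrMr //; lra.
have n0 : 0 < n%:R :> R by rewrite -(pmulr_rgt0 _ b0); lra.
have {}kl : b * n%:R < k%:R by apply: le_lt_trans kl; rewrite ler_pM2r.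
have {}ku : k%:R < (1 / 2 - b) * n%:R by apply: lt_le_trans ku _; rewrite ler_pM2r //; lra.
have k0 : (0 < k)%N by rewrite -(ltr_nat R); clear -n2 kl; lra.
have k2n : (k.*2 < n)%N.
  rewrite -(ltr_nat R) -mul2n natrM; clear -ku b0 n0.
  by have := mulr_gt0 b0 n0; lra.
have N0 : 0 < 'C(n, k)%:R :> R by rewrite ltr0n bin_gt0; clear -k2n; lia.
have D0 : 0 < 'C(n - k, k)%:R :> R by rewrite ltr0n bin_gt0; clear -k2n; lia.
have p0 : 0 < p by apply: lt_le_trans pl; rewrite mulr_gt0 // invr_gt0.
have bka : b <= k%:R / n%:R by rewrite ler_pdivlMr // ltW.
have b1 : b <= 1 by lra.
have bad := hyp_prob_bad_le p0 pu b0 b1 e10 e11 th0 th1 ze0 zeth zee (erefl c) bka N0 D0 pl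
  (fun S => @stab n k S n1 n2 kl ku).
rewrite hyp_prob_compl opprB addrC subrK ger0_norm; last by rewrite hyp_prob_ge0 // ltW.
apply: le_trans (_ : hyp_prob k p (fun H => [exists F, bad_witness k p e1 theta H F]) <= _).
  apply: hyp_prob_le => // [|H]; first exact: ltW.
  rewrite /= negb_forall => /existsP[F]; rewrite negb_imply => /andP[/and3P[FH iF cF] nF].
  apply/existsP; exists F; rewrite /bad_witness FH iF cF /=.
  apply: contra nF => /existsP[i iF']; apply/existsP; exists i; apply: le_trans iF' _.
  by rewrite !ler_pM2r // ?divr_gt0 // ltr0n.
apply: le_trans bad _.
have H : s * n%:R <= c / 2 * p * 'C(n, k)%:R.
  have := bin_ratio_ge (ltW b0) k0 k2n (ltW kl) => ratio.
  have h1 : C <= p * 'C(n - k, k)%:R by move: pl; rewrite ler_pdivrMr.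
  have h2 : C * b ^+ 2 * n%:R <= p * 'C(n, k)%:R.
    have h3 := ler_wpM2r (mulr_ge0 (sqr_ge0 b) (ltW n0)) h1.
    have h4 := ler_wpM2l (ltW p0) ratio.
    clear -h3 h4; lra.
  have := ler_wpM2l (_ : 0 <= c / 2) h2; rewrite /s => /(_ ltac:(lra)).
  by clear; lra.
rewrite expRN -[e]invrK lef_pV2 ?posrE ?expR_gt0 ?invr_gt0 //.
(* The linear bound exp(x) >= 1 + x is enough here, since x >= s n. *)
apply: le_trans (expR_ge1Dx _).
move: n3; rewrite ler_pdivrMr // => n3; apply: le_trans n3 _; rewrite mulrC.
by apply: le_trans H _; rewrite lerDr.
Unshelve. all: by end_near.
Qed.
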